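(* Let $s$ be odd, let $k\ge 5$, and let $n\ge n_0(s,k)$, where $n_0(s,k)$ is some function depending only on $s$ and $k$. Let $\mathcal F\subset\binom{[n]}{k}$ be an extremal family (i.e. one of maximum possible cardinality) that does not contain a sunflower with $s$ petals and the core of size $1$. Then there exists a graph $G=K_1\sqcup K_2$ consisting of two disjoint cliques $K_1,K_2$ of size $s$ (with $V(G)\subset[n]$) such that $$\mathcal F=\Big\{F\in\binom{[n]}{k} : |F\cap V(G)|\ge 2 \text{ and for all } i\in\{1,2\} \text{ we have } |F\cap V(K_i)|\ne 1\Big\}.$$
   Context: $[n]=\{1,\dots,n\}$, and $\binom{X}{k}$ is the family of all $k$-element subsets of $X$. A family of $s$ sets $\{F_1,\dots,F_s\}$ is a sunflower with $s$ petals if $F_i\cap F_j=\bigcap_{u=1}^s F_u$ for all distinct $i,j\in\{1,\dots,s\}$; the set $\bigcap_{u=1}^s F_u$ is called its core. $V(H)$ denotes the vertex set of a graph $H$; a clique of size $s$ is a complete graph on $s$ vertices.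
   Formalization: The formal theorem assumes s > 1 (so s is odd and at least 3); for s = 1 the claim fails, since no sunflower with one petal has a core of size 1, so the extremal family is all k-sets while the displayed family is empty. *)

(* Defs.v *)
(* [n] is rendered as the n-element type 'I_n. *)
From mathcomp Require Import all_boot.

Set Implicit Arguments.
Unset Strict Implicit.
Unset Printing Implicit Defensive.

Definition ksubsets (T : finType) (k : nat) (X : {set T}) : {set {set T}} :=
  [set A : {set T} | (A \subset X) && (#|A| == k)].

Definition core (T : finType) (S : {set {set T}}) : {set T} :=
  \bigcap_(A in S) A.

(* The petals are the members of S, so they are pairwise distinct sets. *)
Definition sunflower (T : finType) (s : nat) (S : {set {set T}}) : Prop :=
  #|S| = s /\ forall A B, A \in S -> B \in S -> A != B -> A :&: B = core S.

Definition contains_sunflower (T : finType) (s c : nat) (F : {set {set T}}) :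
    Prop :=
  exists S : {set {set T}}, [/\ S \subset F, sunflower s S & #|core S| = c].

Definition admissible (s k n : nat) (F : {set {set 'I_n}}) : Prop :=
  F \subset ksubsets k [set: 'I_n] /\ ~ contains_sunflower s 1 F.

Definition extremal (s k n : nat) (F : {set {set 'I_n}}) : Prop :=
  admissible s k F /\
  forall F' : {set {set 'I_n}}, admissible s k F' -> #|F'| <= #|F|.

(* Finite simple graphs whose vertex set is a subset of T. *)
Record graph (T : finType) := Graph {
  vertices : {set T};
  edges : {set {set T}};
  edges_sub : edges \subset ksubsets 2 vertices
}.

Definition is_clique (T : finType) (s : nat) (K : graph T) : Prop :=
  #|vertices K| = s /\ edges K = ksubsets 2 (vertices K).

Definition is_disjoint_union (T : finType) (G K1 K2 : graph T) : Prop :=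
  [/\ [disjoint vertices K1 & vertices K2],
      vertices G = vertices K1 :|: vertices K2
    & edges G = edges K1 :|: edges K2].

(* Main.v *)
(* A q-kernel is a set B that is the common pairwise intersection of q members
   of F.  For q = s k, kernels and members of F can be mixed: s of them (of size
   at least 2) never form a sunflower with a one-point core.  By Füredi's
   intersection semilattice lemma, all but O(n^(k-3)) members A of F contain a
   pair D such that D and all D + x, x in A \ D, are kernels; this uses k >= 5.
   For a fixed x, the kernel pairs D such that D + x is a kernel form a graph
   with neither a star nor a matching of size s, hence with at most s (s - 1)
   edges, by Abbott, Hanson and Sauer.  Comparing sum_D |N(D)|^(k-2), where N(D)
   is the set of x for which D + x is a kernel, with the lower bound given by the
   two-clique family yields s (s - 1) pairs with |N(D)| >= n - O(1).  They form
   an extremal graph, that is two disjoint cliques K1, K2 of size s (s is odd).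
   A member of F meeting K_i in one point would make a forbidden sunflower with
   the s - 1 pairs of K_i at that point.  A member disjoint from both cliques has
   all its points outside some N(D), so there are O(1) such members; if there is
   one, then Omega(n^(k-3)) sets of the two-clique family are missing from F. *)
Require Import Defs.
From mathcomp Require Import all_boot zify.

Set Implicit Arguments.
Unset Strict Implicit.
Unset Printing Implicit Defensive.

(** * Kernels *)

Lemma subset_of_card (T : finType) (m : nat) (A B : {set T}) :
  A \subset B -> #|A| <= m <= #|B| ->
  exists C : {set T}, [/\ A \subset C, C \subset B & #|C| = m].
Proof.
move=> sAB /andP[leAm lemB].
have [d Hd] : exists d, #|A| + d = m by exists (m - #|A|); rewrite subnKC.
elim: d A sAB leAm Hd => [|d IH] A sAB leAm Hd.
  by exists A; split=> //; rewrite -Hd addn0.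
have /properP[_ [x xB xA]] : A \proper B by rewrite properEcard sAB /=; lia.
have cA : #|x |: A| = #|A|.+1 by rewrite cardsU1 xA.
have [|||C [sC sCB cC]] := IH (x |: A).
- by rewrite subUset sub1set xB.
- by rewrite cA; lia.
- by rewrite cA; lia.
by exists C; split=> //; apply: subset_trans sC; apply: subsetUr.
Qed.

Lemma card_bigcup_leq (I T : finType) (P : {set I}) (f : I -> {set T}) :
  #|\bigcup_(i in P) f i| <= \sum_(i in P) #|f i|.
Proof.
apply: (big_ind2 (fun (X : {set T}) m => #|X| <= m)); rewrite ?cards0 //.
by move=> X m Y n hX hY; apply: leq_trans (leq_card_setU _ _) (leq_add hX hY).
Qed.

Lemma card_ksubsets (T : finType) k (X : {set T}) : #|ksubsets k X| = 'C(#|X|, k).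
Proof. exact: cards_draws. Qed.

Section Kernels.
Variable T : finType.
Implicit Types (A B D W : {set T}) (F S : {set {set T}}).

(** A sunflower with prescribed core [B] and no prescribed number of petals. The condition is
    vacuous when [S] has at most one member, which is why [1 < #|S|] is needed to conclude that [B]
    lies in the members of [S]. *)
Definition meets_in B S : bool :=
  [forall A in S, forall A' in S, (A != A') ==> (A :&: A' == B)].

Lemma meets_inP B S :
  reflect {in S &, forall A A', A != A' -> A :&: A' = B} (meets_in B S).
Proof.
apply: (iffP forall_inP) => [h A A' SA SA' neq|h A SA].
  by have /forall_inP/(_ A' SA')/implyP/(_ neq)/eqP := h A SA.
by apply/forall_inP => A' SA'; apply/implyP => neq; apply/eqP; apply: h.
Qed.

Lemma meets_inS B S S' : S' \subset S -> meets_in B S -> meets_in B S'.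
Proof.
by move=> /subsetP sS /meets_inP h; apply/meets_inP => A A' /sS ? /sS ?; apply: h.
Qed.

Lemma meets_in_sub B S A : meets_in B S -> 1 < #|S| -> A \in S -> B \subset A.
Proof.
move=> /meets_inP mS S1 SA.
have : 0 < #|S :\ A| by move: S1; rewrite (cardsD1 A S) SA.
case/card_gt0P => A'; rewrite !inE => /andP[neq SA'].
by rewrite -(mS A' A) // subsetIr.
Qed.

(** Outside [B] the members of [S] are pairwise disjoint, so a point of [W] is counted at most
    once. *)
Lemma meets_in_sum B S W :
  meets_in B S -> [disjoint W & B] -> \sum_(A in S) #|A :&: W| <= #|W|.
Proof.
move=> /meets_inP mS dWB.
have -> : \sum_(A in S) #|A :&: W| = \sum_(y in W) \sum_(A in S) (y \in A).
  rewrite exchange_big /=; apply: eq_bigr => A _.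
  rewrite -sum1_card big_mkcond [RHS]big_mkcond /=.
  by apply: eq_bigr => y _; rewrite inE andbC; case: (y \in W) => //=; case: (y \in A).
rewrite -sum1_card; apply: leq_sum => y Wy.
have [/exists_inP[A SA yA]|] := boolP [exists A in S, y \in A]; last first.
  move=> /exists_inPn h; rewrite big1 // => A SA.
  by rewrite (negbTE (h _ SA)).
rewrite (bigD1 A) //= yA big1 // => A' /andP[SA' neq].
apply/eqP; rewrite eqb0; apply/negP => yA'.
have : y \in B by rewrite -(mS _ _ SA' SA neq) inE yA'.
by rewrite (disjointFr dWB Wy).
Qed.

(** If every petal met [W :\: B], disjointness outside [B] would give [W] at least [#|S|] points. *)
Lemma meets_in_avoid B S W :
  meets_in B S -> 1 < #|S| -> #|W| < #|S| ->
  exists2 A, A \in S & A :&: W \subset B.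
Proof.
move=> mS S1 ltWS.
have dW : [disjoint W :\: B & B] by rewrite -setI_eq0 setIDAC -setIDA setDv setI0.
have [/exists_inP[A SA /eqP AW0]|] :=
    boolP [exists A in S, A :&: (W :\: B) == set0].
  by exists A => //; rewrite -setD_eq0 -setIDA; apply/eqP.
move=> /exists_inPn h.
have := meets_in_sum mS dW.
have : #|S| <= \sum_(A in S) #|A :&: (W :\: B)|.
  rewrite -sum1_card; apply: leq_sum => A SA.
  by rewrite card_gt0; apply: h.
have := subset_leq_card (subsetDl W B); lia.
Qed.

Lemma meets_inU1 B A S :
  {in S, forall A' : {set T}, A :&: A' = B} -> meets_in B S -> meets_in B (A |: S).
Proof.
move=> hA /meets_inP mS; apply/meets_inP => A1 A2; rewrite !inE.
move=> /orP[/eqP->|S1] /orP[/eqP->|S2] neq; first by rewrite eqxx in neq.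
- exact: hA.
- by rewrite setIC hA.
- exact: mS.
Qed.

Lemma meets_in_pairs v S :
  {in S, forall D : {set T}, #|D| = 2 /\ v \in D} -> meets_in [set v] S.
Proof.
move=> hS; apply/meets_inP => D D' /hS[D2 vD] /hS[D'2 vD'] neq.
apply/eqP; rewrite eq_sym eqEcard subsetI !sub1set vD vD' cards1 /=.
rewrite leqNgt; apply/negP => lt; case/negP: neq.
have e1 : D :&: D' = D by apply/eqP; rewrite eqEcard subsetIl D2.
have e2 : D :&: D' = D' by apply/eqP; rewrite eqEcard subsetIr D'2.
by rewrite -e1 e2.
Qed.

Definition kernel (q : nat) F B : bool :=
  [exists S : {set {set T}}, [&& S \subset F, q <= #|S| & meets_in B S]].

Lemma kernelP q F B :
  reflect (exists S, [/\ S \subset F, q <= #|S| & meets_in B S]) (kernel q F B).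
Proof.
apply: (iffP existsP) => -[S]; first by case/and3P=> *; exists S.
by case=> *; exists S; apply/and3P.
Qed.

Lemma kernelS q F F' B : F \subset F' -> kernel q F B -> kernel q F' B.
Proof.
move=> sF /kernelP[S [sS qS mS]]; apply/kernelP; exists S; split=> //.
exact: subset_trans sF.
Qed.

(** This is how kernels get used: a member of [F] through [B] can be chosen to stay clear of a small
    set outside [B]. *)
Lemma kernel_avoid q F B W :
  kernel q F B -> 1 < q -> #|W| < q ->
  exists A, [/\ A \in F, B \subset A & A :&: W \subset B].
Proof.
move=> /kernelP[S [sS qS mS]] q1 Wq.
have S1 := leq_trans q1 qS.
have [A SA AW] := meets_in_avoid mS S1 (leq_trans Wq qS).
by exists A; split=> //; [apply: (subsetP sS) | apply: meets_in_sub SA].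
Qed.

Lemma core_meets_in B S : meets_in B S -> 1 < #|S| -> core S = B.
Proof.
move=> mS S1; apply/eqP; rewrite eqEsubset; apply/andP; split; last first.
  by apply/bigcapsP => A SA; apply: meets_in_sub SA.
have : 0 < #|S| by lia.
case/card_gt0P => A SA.
have : 0 < #|S :\ A| by move: S1; rewrite (cardsD1 A S) SA.
case/card_gt0P => A'; rewrite !inE => /andP[neq SA'].
move/meets_inP: mS => /(_ _ _ SA SA'); rewrite eq_sym => /(_ neq) <-.
by rewrite subsetI !bigcap_inf.
Qed.

Section NoSunflower.
Variables (s k : nat) (F : {set {set T}}).
Hypotheses (s_gt1 : 1 < s) (k_gt1 : 1 < k).
Hypothesis F_unif : {in F, forall A, #|A| = k}.
Hypothesis F_free : ~ contains_sunflower s 1 F.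

Lemma no_meets_in1 x S :
  S \subset F -> s <= #|S| -> ~ meets_in [set x] S.
Proof.
move=> sS leS mS; apply: F_free.
have [||S' [_ sS' cS']] := @subset_of_card _ s set0 S; rewrite ?sub0set ?cards0 //.
have mS' := meets_inS sS' mS.
have cE : core S' = [set x] by apply: core_meets_in; rewrite ?cS'.
exists S'; split; first exact: subset_trans sS.
  by split=> // A B SA SB neq; rewrite cE; move/meets_inP: mS'; apply.
by rewrite cE cards1.
Qed.

Lemma kernel_neq1 q B : s <= q -> kernel q F B -> #|B| != 1.
Proof.
move=> leq /kernelP[S [sS qS mS]]; apply/negP => /cards1P[x eB]; subst B.
by apply: (no_meets_in1 sS _ mS); apply: leq_trans qS.
Qed.

Lemma kernel_card q B : 1 < q -> kernel q F B -> #|B| <= k.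
Proof.
move=> q1 kB; have [|A [FA sBA _]] := @kernel_avoid q F B set0 kB q1.
  by rewrite cards0; lia.
by rewrite -(F_unif FA); apply: subset_leq_card.
Qed.

(* Kernels with at least s * k petals can be replaced one after the other by
   members of F without creating new intersections. *)
Lemma no_kernel_sunflower x S :
  s <= #|S| -> meets_in [set x] S ->
  {in S, forall B, 1 < #|B| /\ ((B \in F) || kernel (s * k) F B)} -> False.
Proof.
move=> leS mS hS.
have [||S' [_ sS' cS']] := @subset_of_card _ s set0 S; rewrite ?sub0set ?cards0 //.
have {}hS : {in S', forall B, 1 < #|B| /\ ((B \in F) || kernel (s * k) F B)}.
  by move=> B SB; apply: hS; apply: (subsetP sS').
have {mS} mS' := meets_inS sS' mS.
(* Induction on the number of petals that are not yet members of [F]. *)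
have [d] := ubnP #|S' :\: F|.
move: S' cS' hS mS' {sS'}; elim: d => // d IH S' cS hS mS ltd.
have [sSF|/subsetPn[B SB FB]] := boolP (S' \subset F).
  by apply: (no_meets_in1 sSF _ mS); rewrite cS.
have [B1 /orP[|kB]] := hS _ SB; first by rewrite (negbTE FB).
have sk1 : 1 < s * k by rewrite -(muln1 1); apply: ltn_mul.
(* The replacement of [B] has to avoid the other [s - 1] petals; each has at most [k] points, so [W]
   has fewer than [s * k]. *)
set W := \bigcup_(B' in S' :\ B) B'.
have ltW : #|W| < s * k.
  have : #|W| <= \sum_(B' in S' :\ B) k.
    apply: leq_trans (_ : \sum_(B' in S' :\ B) #|B'| <= _).
      exact: card_bigcup_leq.
    apply: leq_sum => B'; rewrite !inE => /andP[_ /hS[_ /orP[FB'|kB']]].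
      by rewrite F_unif.
    exact: kernel_card kB'.
  rewrite sum_nat_const; have := cardsD1 B S'; rewrite SB cS /= => cc.
  move=> h; apply: leq_ltn_trans h _.
  by rewrite ltn_mul2r; apply/andP; split; lia.
have [A [FA sBA AW]] := kernel_avoid kB sk1 ltW.
have xB : x \in B.
  by rewrite -sub1set; apply: meets_in_sub SB => //; rewrite cS.
have AB' B' : B' \in S' -> B' != B -> A :&: B' = [set x].
  move=> SB' neq; have /meets_inP/(_ _ _ SB' SB neq) e := mS.
  rewrite -e; apply/eqP; rewrite eqEsubset; apply/andP; split; last first.
    by rewrite setIC; apply: setSI.
  rewrite subsetI subsetIr /=; apply: subset_trans AW; apply: setIS.
  by apply: (bigcup_sup B'); rewrite // !inE neq.
(* Were [A] already a petal, it would meet itself in [[set x]] only, although it has [k > 1]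
   points. *)
have nA : A \notin S' :\ B.
  apply/negP; rewrite !inE => /andP[neq SA].
  have := AB' _ SA neq; rewrite setIid => eA.
  by move: (F_unif FA); rewrite eA cards1; lia.
apply: (IH (A |: S' :\ B)).
- by rewrite cardsU1 nA; move: (cardsD1 B S'); rewrite SB cS; lia.
- move=> B'; rewrite !inE => /orP[/eqP->|/andP[_ /hS //]].
  by rewrite F_unif // FA; split.
- apply: meets_inU1; last by apply: meets_inS mS; apply: subsetDl.
  by move=> B'; rewrite !inE => /andP[neq SB']; apply: AB'.
- rewrite -ltnS; apply: leq_trans _ ltd; rewrite ltnS; apply: proper_card.
  apply/properP; split.
    by apply/subsetP => X; rewrite !inE => /andP[nX /orP[/eqP eX|/andP[_ ->]]];
       rewrite ?nX //; move: nX; rewrite eX FA.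
  exists B; first by rewrite inE FB.
  rewrite !inE eqxx /= orbF FB /=; apply/negP => /eqP e.
  by move: FB; rewrite e FA.
Qed.

End NoSunflower.

(** Realise [B1] by a member [C1] that avoids [B2] outside [B1], then [B2] by a member [C2] that
    avoids [C1] outside [B2]. Then [C1 :&: C2] is exactly [B1 :&: B2], and [#|B1| < k] makes [C1]
    and [C2] distinct. *)
Lemma kernelI q F k B1 B2 :
  {in F, forall A, #|A| = k} ->
  {in F &, forall A A', A != A' -> kernel q F (A :&: A')} ->
  1 < q -> k < q -> #|B1| < k -> kernel q F B1 -> kernel q F B2 ->
  kernel q F (B1 :&: B2).
Proof.
move=> F_unif F_int q1 kq B1k k1 k2.
have [||A2 [FA2 s2 _]] := @kernel_avoid q F B2 set0 k2 => //.
  by rewrite cards0; lia.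
have cB2 : #|B2| < q by apply: leq_ltn_trans (subset_leq_card s2) _; rewrite F_unif.
have [C1 [FC1 sB1 i1]] := kernel_avoid k1 q1 cB2.
have cC1 : #|C1| < q by rewrite F_unif.
have [C2 [FC2 sB2 i2]] := kernel_avoid k2 q1 cC1.
have e : C1 :&: C2 = B1 :&: B2.
  apply/eqP; rewrite eqEsubset; apply/andP; split; last exact: setISS.
  have h : C1 :&: C2 \subset B2 by rewrite setIC.
  rewrite subsetI h andbT; apply: subset_trans i1.
  by rewrite subsetI subsetIl.
rewrite -e; apply: F_int => //; apply/negP => /eqP eC.
have : #|C1 :&: C2| <= #|B1| by rewrite e; apply: subset_leq_card (subsetIl _ _).
by rewrite -eC setIid F_unif // leqNgt B1k.
Qed.

(** Take a largest sunflower in [F] with core [B]. It has fewer than [q] petals, and by maximality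
    every member of [F] containing [B] meets their union outside [B]. *)
Lemma link_cover q F k B :
  {in F, forall A, #|A| = k} -> #|B| < k -> 0 < q -> ~~ kernel q F B ->
  exists Y : {set T}, [/\ #|Y| <= q * k, [disjoint Y & B] &
    {in F, forall A, B \subset A -> exists2 y, y \in Y & y \in A}].
Proof.
move=> F_unif Bk q0 nk.
pose P (S : {set {set T}}) := [&& S \subset F, meets_in B S &
   [forall A in S, B \subset A]].
have P0 : P set0.
  rewrite /P sub0set /=; apply/andP; split.
    by apply/meets_inP => A A'; rewrite inE.
  by apply/forall_inP => A; rewrite inE.
case: (arg_maxnP (fun S : {set {set T}} => #|S|) P0) => S.
move=> /and3P[sS mS /forall_inP bS] maxS.
exists (cover S :\: B); split.
- apply: leq_trans (subset_leq_card (subsetDl _ _)) _.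
  apply: leq_trans (leq_card_cover S) _.
  rewrite (eq_bigr (fun _ => k)); last first.
    by move=> A SA; apply: F_unif; apply: (subsetP sS).
  rewrite sum_nat_const leq_mul2r; apply/orP; right.
  rewrite leqNgt; apply/negP => ltq; case/negP: nk.
  by apply/kernelP; exists S; split=> //; apply: ltnW.
- by rewrite -setI_eq0 setIDAC -setIDA setDv setI0.
- move=> A FA sBA.
  have [/set0Pn[y]|] := boolP (A :&: (cover S :\: B) != set0).
    by rewrite inE => /andP[? ?]; exists y.
  rewrite negbK => /eqP A0.
  have sAB : A :&: cover S \subset B by rewrite -setD_eq0 -setIDA A0.
  have AS : A \notin S.
    apply/negP => SA; have : A \subset A :&: cover S.
      by rewrite subsetI subxx /=; apply: bigcup_sup.
    move=> /subset_trans/(_ sAB)/subset_leq_card; rewrite F_unif //.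
    by rewrite leqNgt Bk.
  have : P (A |: S).
    have AA' A' : A' \in S -> A :&: A' = B.
      move=> SA'; apply/eqP; rewrite eqEsubset; apply/andP; split.
        by apply: subset_trans sAB; apply: setIS; apply: bigcup_sup.
      by rewrite subsetI sBA bS.
    apply/and3P; split.
    - by rewrite subUset sub1set FA.
    - exact: meets_inU1.
    - by apply/forall_inP => A1; rewrite !inE => /orP[/eqP->|/bS].
  by move/maxS; rewrite /= cardsU1 AS add1n ltnn.
Qed.

End Kernels.

(** * Füredi's intersection semilattice lemma *)

(* Each set B which is an intersection but not a core is destroyed once: the
   members containing B survive only if they contain a popular point of a small
   transversal of the link of B.  The weight r ^ #{destroyed subsets of A} compensates the loss. *)
Lemma furedi_weighted (T : finType) (q k : nat) (F P : {set {set T}}) :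
  {in F, forall A : {set T}, #|A| = k} -> 0 < q -> 0 < k ->
  {in F &, forall A A' : {set T}, A != A' -> A :&: A' \notin P} ->
  exists F' : {set {set T}}, [/\ F' \subset F,
    {in F' &, forall A A' : {set T}, A != A' -> kernel q F' (A :&: A')} &
    \sum_(A in F) (q * k) ^ #|P :&: powerset A| <= (q * k) ^ 2 ^ k * #|F'|].
Proof.
move=> + q0 k0.
have [d] := ubnP #|F|; elim: d F P => // d IH F P ltd F_unif hP.
have r0 : 0 < q * k by rewrite muln_gt0 q0.
have [/forall_inP hF|] := boolP
  [forall A in F, forall A' in F, (A != A') ==> kernel q F (A :&: A')].
  exists F; split=> //.
    by move=> A A' /hF/forall_inP h /h/implyP.
  rewrite [X in _ <= X]mulnC -sum_nat_const; apply: leq_sum => A FA.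
  rewrite leq_pexp2l // -(F_unif _ FA) -card_powerset.
  exact: subset_leq_card (subsetIr _ _).
move=> /forall_inPn[A1 FA1 /forall_inPn[A2 FA2]]; rewrite negb_imply => /andP[neq nker].
set B := A1 :&: A2 in nker.
have Bk : #|B| < k.
  rewrite -(F_unif _ FA1); apply: proper_card; rewrite properEneq subsetIl andbT.
  apply: contraNneq neq => /setIidPl s12.
  by rewrite eqEcard s12 F_unif // F_unif //=.
have [Y [cY dYB hY]] := link_cover F_unif Bk q0 nker.
pose L := [set A in F | B \subset A].
pose w A := (q * k) ^ #|P :&: powerset A|.
have Ycov : \sum_(A in L) w A <= \sum_(y in Y) \sum_(A in L | y \in A) w A.
  rewrite (exchange_big_dep (mem L)) /=; last by move=> y A _ /andP[].
  apply: leq_sum => A; rewrite inE => /andP[FA sBA].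
  have [y Yy yA] := hY _ FA sBA.
  by rewrite (bigD1 y) /= ?Yy ?inE ?FA ?sBA ?yA // leq_addr.
(* Pigeonhole: [Y] has at most [q * k] points, so one of them carries at least that fraction of the
   weight of [L]. *)
have [y Yy hy] : exists2 y, y \in Y &
    \sum_(A in L) w A <= q * k * \sum_(A in L | y \in A) w A.
  have [/exists_inP[y]|/exists_inPn h] := boolP [exists y in Y,
    \sum_(A in L) w A <= q * k * \sum_(A in L | y \in A) w A].
    by exists y.
  exfalso.
  have [y0 Yy0 _] := hY _ FA1 (subsetIl _ _).
  have : \sum_(y in Y) q * k * \sum_(A in L | y \in A) w A <
         \sum_(y in Y) \sum_(A in L) w A.
    rewrite [X in X < _](bigD1 y0) //= [X in _ < X](bigD1 y0) //= -addSn.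
    apply: leq_add; first by rewrite ltnNge h.
    by apply: leq_sum => z /andP[Yz _]; apply: ltnW; rewrite ltnNge h.
  rewrite -big_distrr /= sum_nat_const ltnNge => /negP; apply.
  by apply: leq_mul.
have yB : y \notin B by rewrite (disjointFr dYB Yy).
(* Two members of [F1] containing [B] also share [y], which is outside [B]. Hence [B] is no longer
   an intersection and may join [P]; moreover [A1] or [A2] is lost, so [F1] is smaller. *)
pose F1 := [set A in F | (B \subset A) ==> (y \in A)].
have sF1 : F1 \subset F by apply/subsetP => A; rewrite inE => /andP[].
have BP : B \notin P by apply: hP.
have [|||F' [sF' kF' leF']] := IH F1 (B |: P).
- have : #|F1| < #|F|; last by move: ltd; lia.
  apply: proper_card; apply/properP; split=> //.
  have : ~~ ((y \in A1) && (y \in A2)) by rewrite -in_setI.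
  rewrite negb_and => /orP[yA|yA]; [exists A1 => //|exists A2 => //].
    by rewrite inE FA1 subsetIl (negbTE yA).
  by rewrite inE FA2 subsetIr (negbTE yA).
- by move=> A /(subsetP sF1)/F_unif.
- move=> A A'; rewrite !inE => /andP[FA hA] /andP[FA' hA'] nA.
  rewrite negb_or hP // andbT; apply/negP => /eqP eB.
  move: yB; rewrite -eB inE.
  by move: hA hA'; rewrite -eB subsetIl subsetIr /= => -> ->.
exists F'; split=> //; first exact: subset_trans sF1.
apply: leq_trans leF'.
pose hasB (A : {set T}) := B \subset A.
rewrite (bigID hasB) /= [X in _ <= X](bigID hasB) /= /hasB.
apply: leq_add; last first.
  rewrite [X in _ <= X](eq_bigl (fun A => (A \in F) && ~~ (B \subset A))); last first.
    by move=> A; rewrite inE; case: (B \subset A); rewrite ?andbF //= andbT.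
  apply: leq_sum => A _; rewrite leq_pexp2l //; apply: subset_leq_card.
  by apply: setSI; apply: subsetUr.
have -> : \sum_(A in F | B \subset A) (q * k) ^ #|P :&: powerset A| = \sum_(A in L) w A.
  by apply: eq_bigl => A; rewrite !inE.
apply: leq_trans hy _; rewrite big_distrr /=.
rewrite [X in _ <= X](eq_bigl (fun A => (A \in L) && (y \in A))); last first.
  by move=> A; rewrite !inE; case: (B \subset A); rewrite ?andbF ?andbT.
apply: leq_sum => A; rewrite inE => /andP[/andP[FA sBA] yA].
(* Since [B] is new in [P], the exponent of a surviving [A] grows by one, which absorbs the factor
   [q * k]. *)
rewrite -expnS leq_pexp2l //.
have -> : (B |: P) :&: powerset A = B |: (P :&: powerset A).
  apply/setP => X; rewrite !inE; case: eqP => [->|//]; by rewrite sBA.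
by rewrite cardsU1 !inE (negbTE BP).
Qed.

Lemma furedi (T : finType) (q k : nat) (F : {set {set T}}) :
  {in F, forall A : {set T}, #|A| = k} -> 0 < q -> 0 < k ->
  exists F' : {set {set T}}, [/\ F' \subset F,
    {in F' &, forall A A' : {set T}, A != A' -> kernel q F' (A :&: A')} &
    #|F| <= (q * k) ^ 2 ^ k * #|F'|].
Proof.
move=> F_unif q0 k0.
have [|F' [sF kF leF]] := @furedi_weighted T q k F set0 F_unif q0 k0.
  by move=> A A' _ _ _; rewrite inE.
exists F'; split=> //; apply: leq_trans leF.
by rewrite -sum1_card; apply: leq_sum => A _; rewrite set0I cards0.
Qed.

(* Take an uncovered G of minimal size, so #|A :\: G| <= 2.  For h in G
   some B h in M contains G minus h; the intersection C g of the B h with h <> g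
   meets G in g only.  As M has no singletons and #|G| >= 3, this forces C g = g |: (A :\: G). *)
Lemma closed_family_pair (T : finType) (A : {set T}) (M : {set {set T}}) :
  5 <= #|A| -> {in M, forall B : {set T}, B \proper A} ->
  {in M &, forall B B' : {set T}, B :&: B' \in M} ->
  {in M, forall B : {set T}, #|B| != 1} ->
  (forall G : {set T}, G \subset A -> #|G| <= #|A| - 3 ->
    exists2 B, B \in M & G \subset B) ->
  exists D : {set T}, [/\ D \subset A, #|D| = 2, D \in M &
    {in A :\: D, forall x, x |: D \in M}].
Proof.
move=> A5 Mpr MI M1 Mcov.
pose unc (G : {set T}) := (G \subset A) && [forall B in M, ~~ (G \subset B)].
have uncA : unc A.
  rewrite /unc subxx /=; apply/forall_inP => B /Mpr.
  by rewrite properE => /andP[].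
case: (arg_minnP (fun G : {set T} => #|G|) uncA) => G /andP[sGA /forall_inP uG] minG.
have cG : #|A| - 2 <= #|G|.
  rewrite leqNgt; apply/negP => h.
  have [|B MB sGB] := Mcov G sGA; first lia.
  by move: (uG _ MB); rewrite sGB.
pose D := A :\: G.
have cD : #|D| <= 2.
  by have := cardsD A G; rewrite (setIidPr sGA) -/D; lia.
have Bex g : g \in G -> {B | [&& B \in M, G :\ g \subset B & g \notin B]}.
  move=> Gg; apply/sigW.
  have /negP nu : ~~ unc (G :\ g).
    apply/negP => /minG; rewrite (cardsD1 g G) Gg; lia.
  have [/exists_inP[B MB sB]|/exists_inPn h] :=
      boolP [exists B in M, G :\ g \subset B].
    exists B; rewrite MB sB /=; apply/negP => gB; move/negP: (uG _ MB); apply.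
    by rewrite -(setD1K Gg) subUset sub1set gB.
  case: nu; rewrite /unc (subset_trans (subsetDl _ _) sGA) /=.
  by apply/forall_inP.
pose Bf g := if @idP (g \in G) is ReflectT Gg then sval (Bex g Gg) else set0.
have BfP g : g \in G -> [/\ Bf g \in M, G :\ g \subset Bf g & g \notin Bf g].
  move=> Gg; rewrite /Bf; case: {-}_ / idP => // Gg'.
  by case: (Bex g Gg') => B /= /and3P[].
have capM (I : {set T}) i : i \in I -> I \subset G ->
    \bigcap_(h in I) Bf h \in M.
  move=> Ii sI; rewrite (bigD1 i) //=.
  have Bi := BfP _ (subsetP sI _ Ii); case: Bi => Mi _ _.
  elim/big_rec: _ => [|h X /andP[Ih _] MX]; first by rewrite setIT.
  rewrite setICA; apply: MI => //.
  by have [] := BfP _ (subsetP sI _ Ih).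
pose C g := \bigcap_(h in G :\ g) Bf h.
have CM g : g \in G -> C g \in M.
  move=> Gg; have : 0 < #|G :\ g| by move: (cardsD1 g G); rewrite Gg; lia.
  case/card_gt0P => h Gh; apply: (capM _ h Gh); exact: subsetDl.
have CG g h : g \in G -> h \in G -> (h \in C g) = (h == g).
  move=> Gg Gh; apply/bigcapP/eqP => [hC|->].
    apply/eqP; apply/negPn/negP => neq; have [_ _ /negP] := BfP _ Gh.
    by apply; apply: hC; rewrite !inE neq.
  move=> l; rewrite !inE => /andP[neq Gl]; have [_ /subsetP + _] := BfP _ Gl.
  by apply; rewrite !inE eq_sym neq.
have CA g : g \in G -> C g \subset A.
  by move=> /CM/Mpr; apply: proper_sub.
pose P g := C g :&: D.
have CP g : g \in G -> C g = g |: P g.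
  move=> Gg; apply/setP => x; rewrite !inE.
  have [Gx|Gx] /= := boolP (x \in G).
    by rewrite CG // andbF orbF.
  have [->|_] := eqVneq x g; first by rewrite CG ?eqxx.
  case xC: (x \in C g) => //=; by rewrite (subsetP (CA _ Gg)).
have P0 g : g \in G -> 0 < #|P g|.
  move=> Gg; rewrite lt0n; apply/negP => /eqP/cards0_eq e.
  by have := M1 _ (CM _ Gg); rewrite CP // e setU0 cards1.
have PP g h : g \in G -> h \in G -> g != h -> #|P g :&: P h| != 1.
  move=> Gg Gh neq; have := M1 _ (MI _ _ (CM _ Gg) (CM _ Gh)).
  suff -> : C g :&: C h = P g :&: P h by [].
  apply/setP => x; rewrite /P !inE.
  have [Gx|Gx] /= := boolP (x \in G).
    rewrite !CG // !andbF; apply/negbTE; apply/negP => /andP[/eqP-> /eqP e].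
    by rewrite e eqxx in neq.
  case xC: (x \in C g) => //=.
  by case: (x \in C h); rewrite ?andbF ?(subsetP (CA _ Gg) _ xC).
have PD g : P g \subset D by apply: subsetIr.
have P2 g : g \in G -> P g = D /\ #|D| = 2.
  move=> Gg.
  suff cP : 2 <= #|P g|.
    have e : P g = D.
      by apply/eqP; rewrite eqEcard PD (leq_trans cD).
    by split=> //; apply/eqP; rewrite eqn_leq cD -e.
  (* If [P g] were a single point, every other [P h] would avoid it and be the one remaining point
     of [D]; two such sets would then meet in exactly one point, against [PP]. *)
  rewrite ltnNge; apply/negP => le1.
  have small h : h \in G -> h != g -> P h = D :\: P g.
    move=> Gh neq; have i0 : P h :&: P g = set0.
      apply: cards0_eq; move: (PP _ _ Gh Gg neq).
      have := subset_leq_card (subsetIr (P h) (P g)).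
      by move: (P0 _ Gg) le1; lia.
    apply/eqP; rewrite eqEcard subsetD PD /= -setI_eq0 i0 eqxx /=.
    have := cardsD D (P g); rewrite (setIidPr (PD g)).
    by move: (P0 _ Gg) (P0 _ Gh); lia.
  have : 1 < #|G :\ g| by move: (cardsD1 g G); rewrite Gg; lia.
  case/card_gt1P => h [l [+ + neq]]; rewrite !inE.
  move=> /andP[nh Gh] /andP[nl Gl].
  have := PP _ _ Gh Gl neq; rewrite (small l) // -(small h) // setIid.
  have := P0 _ Gh; rewrite (small h) //.
  have := cardsD D (P g); rewrite (setIidPr (PD g)).
  by move: (P0 _ Gg); lia.
have : 1 < #|G| by lia.
case/card_gt1P => u [v [Gu Gv neq]].
have [eg D2] := P2 _ Gu; have [eh _] := P2 _ Gv.
exists D; split=> //.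
- exact: subsetDl.
- have := MI _ _ (CM _ Gu) (CM _ Gv); rewrite !CP // eg eh.
  suff -> : (u |: D) :&: (v |: D) = D by [].
  apply/setP => x; rewrite !inE.
  have [Gx|Gx] /= := boolP (x \in G).
    rewrite !orbF; apply/negbTE; apply/negP => /andP[/eqP-> /eqP e].
    by rewrite e eqxx in neq.
  case: (x \in A); rewrite ?orbT //= ?orbF.
  apply/negbTE; apply/negP => /andP[/eqP-> /eqP e].
  by rewrite e eqxx in neq.
- move=> x; rewrite /D !inE => /andP[+ Ax]; rewrite Ax andbT negbK => Gx.
  by rewrite -/D -(P2 _ Gx).1 -CP // CM.
Qed.

Definition anchored (T : finType) (q : nat) (F : {set {set T}}) (A D : {set T}) :=
  [&& D \subset A, #|D| == 2, kernel q F D &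
      [forall x in A :\: D, kernel q F (x |: D)]].

(** Pass to the subfamily [R'] that Füredi's lemma finds among the unanchored members. If all
    (k-3)-subsets of [A] in [R'] lay in kernels properly inside [A], then [closed_family_pair] would
    anchor [A]. So some (k-3)-subset lies in no such kernel; it is contained in no other member of
    [R'], since the intersection of that member with [A] would be one. This injects [R'] into the
    (k-3)-sets. *)
Lemma card_unanchored (T : finType) (s k : nat) (F : {set {set T}}) :
  1 < s -> 5 <= k -> {in F, forall A : {set T}, #|A| = k} ->
  ~ contains_sunflower s 1 F ->
  #|[set A in F | ~~ [exists D, anchored (s * k) F A D]]| <=
    (s * k * k) ^ 2 ^ k * 'C(#|T|, k - 3).
Proof.
move=> s1 k5 F_unif F_free; set R := [set A in F | _]; set q := s * k.
have sRF : R \subset F by apply/subsetP => A; rewrite inE => /andP[].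
have R_unif : {in R, forall A : {set T}, #|A| = k} by move=> A /(subsetP sRF)/F_unif.
have kq : k < q by rewrite /q -{1}(mul1n k) ltn_mul2r; lia.
have [||R' [sR' kR' leR]] := @furedi T q k R R_unif; [lia|lia|].
apply: leq_trans leR _; rewrite leq_mul2l; apply/orP; right.
have R'_unif : {in R', forall A : {set T}, #|A| = k} by move=> A /(subsetP sR')/R_unif.
have own A : A \in R' -> {G : {set T} | [&& #|G| == k - 3, G \subset A &
    [forall A' in R', (G \subset A') ==> (A' == A)]]}.
  move=> RA; apply/sigW.
  pose M := [set B : {set T} | (B \proper A) && kernel q R' B].
  have [/existsP[G /and3P[cG sG hG]]|] := boolP [exists G : {set T},
      [&& #|G| == k - 3, G \subset A & [forall B in M, ~~ (G \subset B)]]].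
    exists G; rewrite cG sG /=; apply/forall_inP => A' RA'.
    apply/implyP => sGA'; apply/negPn/negP => neq.
    move/forall_inP: hG => /(_ (A :&: A')); rewrite subsetI sG sGA' inE.
    suff -> : (A :&: A' \proper A) && kernel q R' (A :&: A') by move=> /(_ isT).
    apply/andP; split; last by apply: kR'; rewrite 1?eq_sym.
    rewrite properEneq subsetIl andbT; apply: contraNneq neq => /setIidPl sAA'.
    by rewrite eq_sym eqEcard sAA' !R'_unif //=.
  move=> /existsPn nG; exfalso.
  have := subsetP sR' _ RA; rewrite inE => /andP[FA /existsP]; case.
  have [|||||D [sDA cD MD hD]] := @closed_family_pair T A M.
  - by rewrite R'_unif.
  - by move=> B; rewrite inE => /andP[].
  - move=> B B'; rewrite !inE => /andP[pB kB] /andP[pB' kB'].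
    rewrite (sub_proper_trans (subsetIl _ _) pB) /=.
    apply: (kernelI R'_unif) => //; first lia.
    by rewrite -(R'_unif _ RA); apply: proper_card.
  - move=> B; rewrite inE => /andP[_ kB].
    have kB' : kernel q F B.
      by apply: kernelS kB; apply: subset_trans sRF.
    apply: (kernel_neq1 s1 F_free _ kB').
    by rewrite /q -{1}(muln1 s) leq_mul2l; lia.
  - move=> G sGA cG.
    have [|G' [sG' sG'A cG']] := @subset_of_card T (k - 3) G A sGA.
      by move: cG; rewrite (R'_unif _ RA); lia.
    move: (nG G'); rewrite cG' eqxx sG'A /= => /forall_inPn[B MB].
    by rewrite negbK => sGB; exists B => //; apply: subset_trans sGB.
  exists D; rewrite /anchored sDA cD eqxx /=.
  have up B : B \in M -> kernel q F B.
    rewrite inE => /andP[_]; apply: kernelS; exact: subset_trans sRF.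
  by rewrite up //=; apply/forall_inP => x /hD/up.
pose g A := if @idP (A \in R') is ReflectT RA then sval (own A RA) else set0.
have gP A : A \in R' -> [/\ #|g A| = k - 3, g A \subset A &
    forall A', A' \in R' -> g A \subset A' -> A' = A].
  move=> RA; rewrite /g; case: {-}_ / idP => // RA'.
  case: (own A RA') => G /= /and3P[/eqP cG sG /forall_inP hG]; split=> //.
  by move=> A' /hG/implyP h /h/eqP.
have g_inj : {in R' &, injective g}.
  move=> A A' RA RA' e; have [_ sA _] := gP _ RA; have [_ _ h] := gP _ RA'.
  by apply: h => //; rewrite -e.
rewrite -(card_in_imset g_inj) -(card_draws T).
apply: subset_leq_card; apply/subsetP => _ /imsetP[A RA ->].
by rewrite inE; have [-> _ _] := gP _ RA.
Qed.

(** * Graphs with bounded degree and matching number *)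

Lemma cards2_eq (T : finType) (D : {set T}) x y :
  #|D| = 2 -> x \in D -> y \in D -> x != y -> D = [set x; y].
Proof.
move=> D2 Dx Dy neq; apply/esym/eqP; rewrite eqEcard cards2 neq D2 leqnn andbT.
by rewrite subUset !sub1set Dx Dy.
Qed.

Section Matchings.
Variables (T : finType) (E : {set {set T}}).
Hypothesis E2 : {in E, forall D : {set T}, #|D| = 2}.

Lemma card_cover_matching (M : {set {set T}}) :
  M \subset E -> trivIset M -> #|cover M| = 2 * #|M|.
Proof.
move=> sM /eqP<-; rewrite mulnC -sum_nat_const.
by apply: eq_bigr => D MD; apply: E2; apply: (subsetP sM).
Qed.

Lemma matchingU1 (D : {set T}) (M : {set {set T}}) :
  D \in E -> M \subset E -> trivIset M -> [disjoint D & cover M] ->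
  [/\ D |: M \subset E, trivIset (D |: M) & #|D |: M| = #|M|.+1].
Proof.
move=> ED sM tM dD.
have [||t n] := @trivIsetU1 T D M _ tM.
- move=> B MB; apply: disjointWr dD; exact: bigcup_sup.
- by apply/negP => /(subsetP sM)/E2; rewrite cards0.
- by split; rewrite ?cardsU1 ?n // subUset sub1set ED.
Qed.

Section Gallai.
Variable nu : nat.
Hypothesis nu_max :
  forall M : {set {set T}}, M \subset E -> trivIset M -> #|M| <= nu.

Definition maximum_matching (M : {set {set T}}) :=
  [&& M \subset E, trivIset M & #|M| == nu].

Hypothesis missable : forall v, exists2 M, maximum_matching M & v \notin cover M.

(* Gallai's lemma: since every vertex is missed by some maximum matching, this
   is an equivalence relation. *)
Definition never_both_missed (u v : T) : bool :=
  (u == v) || [forall M : {set {set T}},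
    maximum_matching M ==> (u \in cover M) || (v \in cover M)].

Lemma never_both_missedP u v M :
  never_both_missed u v -> u != v -> maximum_matching M -> u \notin cover M ->
  v \in cover M.
Proof.
rewrite /never_both_missed => /orP[->//|/forallP/(_ M)/implyP h] _ /h.
by case/orP => [->|].
Qed.

Lemma never_both_missed_sym u v : never_both_missed u v = never_both_missed v u.
Proof.
rewrite /never_both_missed eq_sym; congr orb; apply: eq_forallb => M.
by rewrite orbC.
Qed.

(** A maximum matching missing both ends of an edge could be enlarged by it. *)
Lemma edge_never_both_missed D u v :
  D \in E -> u \in D -> v \in D -> never_both_missed u v.
Proof.
move=> ED Du Dv; rewrite /never_both_missed; have [//|neq] := eqVneq u v.
apply/forallP => M; apply/implyP => /and3P[sM tM /eqP cM].
rewrite -[_ || _]negbK negb_or; apply/negP => /andP[nu_ nv].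
have [|sD tD cD] := matchingU1 ED sM tM.
  rewrite (cards2_eq (E2 ED) Du Dv neq) disjoint_subset.
  by apply/subsetP => z; rewrite !inE => /orP[/eqP->|/eqP->].
by have := nu_max sD tD; rewrite cD cM ltnn.
Qed.

(* If M misses u and v, let N miss t and share as many edges with M as possible;
   then an edge of N can be exchanged for one of M. *)
Lemma never_both_missed_trans u t v :
  never_both_missed u t -> never_both_missed t v -> never_both_missed u v.
Proof.
move=> ut tv; have [->//|nut] := eqVneq u t.
have [eq_tv|ntv] := eqVneq t v; first by rewrite -eq_tv.
have [->|nuv] := eqVneq u v; first by rewrite /never_both_missed eqxx.
rewrite /never_both_missed (negbTE nuv) /=.
apply/forallP => M; apply/implyP => mM.
rewrite -[_ || _]negbK negb_or; apply/negP => /andP[uM vM].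
have [N0 mN0 tN0] := missable t.
pose Q N := maximum_matching N && (t \notin cover N).
have QN0 : Q N0 by rewrite /Q mN0.
case: (arg_maxnP (fun N : {set {set T}} => #|M :&: N|) QN0) => N.
move=> /andP[mN tN] maxN.
have uN : u \in cover N.
  by apply: never_both_missedP mN tN; rewrite 1?never_both_missed_sym 1?eq_sym.
have vN : v \in cover N by apply: never_both_missedP mN tN.
move: (mM) (mN) => /and3P[sM tM /eqP cM] /and3P[sN trN /eqP cN].
have ccM := card_cover_matching sM tM; have ccN := card_cover_matching sN trN.
(* Both matchings cover [2 * nu] vertices and [N] covers [u] and [v], which [M] misses; so [M]
   covers at least two vertices missed by [N], one of them different from [t]. *)
have [x] : exists x, x \in (cover M :\: cover N) :\ t.
  apply/card_gt0P.
  have h2 : 2 <= #|cover N :\: cover M|.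
    have <- : #|[set u; v]| = 2 by rewrite cards2 nuv.
    apply: subset_leq_card; apply/subsetP => z; rewrite !inE.
    by move=> /orP[/eqP->|/eqP->]; apply/andP.
  have e1 := cardsID (cover N) (cover M); have e2 := cardsID (cover M) (cover N).
  rewrite setIC in e2.
  move: e1 e2 h2 (cardsD1 t (cover M :\: cover N)).
  rewrite ccM ccN cM cN; move: #|_ :\: _ :\ _| #|_ :&: _| #|_ :\: _| #|_ :\: _|.
  by case: (t \in cover M :\: cover N); clear; lia.
rewrite !inE => /and3P[nxt xN /bigcupP[D MD Dx]].
have ED : D \in E by apply: (subsetP sM).
(* Otherwise [D] could be added to [N]. *)
have [y Dy yN] : exists2 y, y \in D & y \in cover N.
  apply/exists_inP; rewrite -[X in is_true X]negbK; apply/negP => /exists_inPn h.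
  have [|sD tD cD] := matchingU1 ED sN trN.
    by rewrite disjoint_subset; apply/subsetP => z /h.
  by have := nu_max sD tD; rewrite cD cN ltnn.
have nxy : x != y by apply: contraNneq xN => ->.
have eD := cards2_eq (E2 ED) Dx Dy nxy.
case/bigcupP: (yN) => D' ND' D'y.
have DN : D \notin N.
  by apply: contra xN => ND; apply/bigcupP; exists D.
have nDD' : D != D' by apply: contraNneq DN => ->.
have D'M : D' \notin M.
  apply/negP => MD'; move/trivIsetP: tM => /(_ _ _ MD MD' nDD').
  by move=> /disjointFr/(_ Dy); rewrite D'y.
have sN1 : N :\ D' \subset E by apply: subset_trans sN; apply: subsetDl.
have tN1 : trivIset (N :\ D') by apply: trivIsetS trN; apply: subsetDl.
have coverN1 z : z \in cover (N :\ D') -> z \in cover N /\ z \notin D'.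
  move=> /bigcupP[B]; rewrite !inE => /andP[nB NB] Bz; split.
    by apply/bigcupP; exists B.
  apply/negP => D'z; move/trivIsetP: trN => /(_ _ _ NB ND' nB).
  by move=> /disjointFr/(_ Bz); rewrite D'z.
have [|sN' tN' cN'] := matchingU1 ED sN1 tN1.
  rewrite disjoint_subset; apply/subsetP => z; rewrite eD !inE.
  move=> /orP[/eqP->|/eqP->]; apply/negP => /coverN1[].
    by rewrite (negbTE xN).
  by rewrite D'y.
(* The exchange of [D'] for [D] still misses [t], as [x != t] and [N] covers [y] but not [t]. It
   shares one more edge with [M], since [D] is in [M] and [D'] is not. *)
have : Q (D |: N :\ D').
  rewrite /Q /maximum_matching sN' tN' cN'; apply/andP; split.
    by have := cardsD1 D' N; rewrite ND' cN add1n => <- /=.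
  apply/negP => /bigcupP[B]; rewrite !inE => /orP[/eqP->|/andP[_ NB] Bt].
    rewrite eD !inE eq_sym (negbTE nxt) /= => /eqP e.
    by rewrite e yN in tN.
  by case/negP: tN; apply/bigcupP; exists B.
move/maxN; apply/negP; rewrite -ltnNge; apply: proper_card; apply/properP; split.
  apply/subsetP => B; rewrite !inE => /andP[MB NB]; rewrite MB NB andbT /=.
  by apply/orP; right; apply: contraNneq D'M => <-.
by exists D; rewrite !inE ?MD ?eqxx // (negbTE DN).
Qed.

(** The parts are the classes of [never_both_missed]. A maximum matching covers [2 * nu] vertices
    and misses at most one vertex of each class. *)
Lemma gallai_partition (M0 : {set {set T}}) : maximum_matching M0 ->
  exists P : {set {set T}}, [/\ partition P [set: T],
  {in E, forall D : {set T}, exists2 c, c \in P & D \subset c} &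
  \sum_(c in P) (#|c| - 1) <= 2 * nu].
Proof.
move=> mM0; pose R := never_both_missed.
have eqR : {in [set: T] & &, equivalence_rel R}.
  move=> x y z _ _ _; split; first by rewrite /R /never_both_missed eqxx.
  move=> xy; apply/idP/idP => h; last exact: never_both_missed_trans h.
  by apply: never_both_missed_trans h; rewrite never_both_missed_sym.
pose P := equivalence_partition R [set: T].
have partP : partition P [set: T] := equivalence_partitionP eqR.
case/and3P: (partP) => /eqP covP tP _.
have classR c u v : c \in P -> u \in c -> v \in c -> R u v.
  move=> Pc cu cv; have := pblock_equivalence_partition eqR (in_setT u) (in_setT v).
  by rewrite -/P (def_pblock tP Pc cu) cv => <-.
exists P; split=> //.
  move=> D ED; have : 0 < #|D| by rewrite E2.
  case/card_gt0P => u Du; exists (pblock P u); first by apply: pblock_mem; rewrite covP.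
  apply/subsetP => v Dv.
  by rewrite pblock_equivalence_partition ?inE //; apply: edge_never_both_missed ED _ _.
move: (mM0) => /and3P[sM tM /eqP cM].
have -> : 2 * nu = \sum_(c in P) #|c :&: cover M0|.
  rewrite -cM -(card_cover_matching sM tM) -[LHS]sum1_card big_mkcond /=.
  rewrite (eq_bigl (mem [set: T])); last by move=> x; rewrite /= inE.
  rewrite (set_partition_big _ partP) /=; apply: eq_bigr => c _.
  rewrite -sum1_card [RHS]big_mkcond [LHS]big_mkcond /=; apply: eq_bigr => x _.
  by rewrite inE; case: (x \in c).
apply: leq_sum => c Pc; rewrite leq_subLR -(cardsID (cover M0) c) addnC leq_add2r.
rewrite leqNgt; apply/negP => /card_gt1P[u [v [+ + neq]]]; rewrite !inE.
move=> /andP[uM cu] /andP[vM cv].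
by case/negP: vM; apply: never_both_missedP mM0 uM => //; apply: classR Pc _ _.
Qed.

End Gallai.

Lemma sum_degrees (d : T -> nat) :
  (forall v, d v = #|[set D in E | v \in D]|) -> \sum_v d v = 2 * #|E|.
Proof.
move=> dE; rewrite (eq_bigr (fun v => \sum_(D in E) (v \in D))); last first.
  move=> v _; rewrite dE -sum1_card [LHS]big_mkcond [RHS]big_mkcond /=.
  by apply: eq_bigr => D _; rewrite inE; case: (D \in E); case: (v \in D).
rewrite exchange_big /= mulnC -sum_nat_const; apply: eq_bigr => D ED.
rewrite -(E2 ED) -sum1_card [RHS]big_mkcond /=; apply: eq_bigr => v _.
by case: (v \in D).
Qed.

Lemma degree_class (P : {set {set T}}) (c : {set T}) v :
  partition P [set: T] ->
  {in E, forall D : {set T}, exists2 c, c \in P & D \subset c} ->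
  c \in P -> v \in c -> #|[set D in E | v \in D]| <= #|c| - 1.
Proof.
move=> /and3P[_ tP _] hP Pc cv.
have -> : #|c| - 1 = #|c :\ v| by rewrite (cardsD1 v c) cv addKn.
apply: leq_trans (leq_imset_card (fun w => [set v; w]) _).
apply: subset_leq_card; apply/subsetP => D; rewrite inE => /andP[ED Dv].
have : 0 < #|D :\ v| by have := cardsD1 v D; rewrite Dv E2 //; lia.
case/card_gt0P => w; rewrite !inE => /andP[nwv Dw].
apply/imsetP; exists w; last by apply: cards2_eq; rewrite 1?eq_sym // E2.
rewrite !inE nwv /=; have [c' Pc' /subsetP sDc'] := hP _ ED.
by rewrite -(def_pblock tP Pc cv) (def_pblock tP Pc' (sDc' _ Dv)) sDc'.
Qed.

End Matchings.

(** Here [a] is the size of a class, [b] is [s], and [d] is the sum of the degrees in the class,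
    each below both [a] and [b]. *)
Lemma class_degree_sum (a b d : nat) : d <= a * minn (a - 1) (b - 1) -> 0 < a ->
  0 < b -> d <= b * (a - 1) /\ (d = b * (a - 1) -> a = 1 \/ a = b).
Proof.
case: a => // a; case: b => // b; rewrite !subn1 /= => + _ _.
case: (leqP a b) => h hd; split; nia.
Qed.

(** Sum the degrees class by class: [2 * #|E|] is at most [s] times the sum of [#|c| - 1], hence at
    most [s * (2 * nu)]. Equality forces it in every class. *)
Lemma edges_missable (T : finType) (s nu : nat) (E M0 : {set {set T}}) :
  {in E, forall D : {set T}, #|D| = 2} -> 0 < s ->
  (forall v, #|[set D in E | v \in D]| < s) ->
  (forall M : {set {set T}}, M \subset E -> trivIset M -> #|M| <= nu) ->
  maximum_matching E nu M0 ->
  (forall v, exists2 M, maximum_matching E nu M & v \notin cover M) ->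
  #|E| <= s * nu /\
  (#|E| = s * nu -> exists P : {set {set T}}, [/\ partition P [set: T],
     {in E, forall D : {set T}, exists2 c, c \in P & D \subset c},
     {in P, forall c : {set T}, #|c| = 1 \/ #|c| = s} &
     \sum_(c in P) (#|c| - 1) = 2 * nu]).
Proof.
move=> E2 s0 degE maxE mM0 missE.
have [P [partP PE sumP]] := gallai_partition E2 maxE missE mM0.
case/and3P: (partP) => _ _ P0.
pose deg v := #|[set D in E | v \in D]|.
have cP c : c \in P -> 0 < #|c|.
  by move=> Pc; rewrite card_gt0; apply: contraNneq P0 => <-.
have classP c : c \in P -> \sum_(v in c) deg v <= s * (#|c| - 1) /\
    (\sum_(v in c) deg v = s * (#|c| - 1) -> #|c| = 1 \/ #|c| = s).
  move=> Pc; apply: class_degree_sum; rewrite ?cP //.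
  rewrite -sum_nat_const; apply: leq_sum => v cv; rewrite leq_min.
  rewrite (degree_class E2 partP PE Pc cv) /=.
  by have := degE v; rewrite -/(deg v); case: (s) => // s' ; rewrite subn1.
have sum2 : 2 * #|E| = \sum_(c in P) \sum_(v in c) deg v.
  rewrite -(sum_degrees E2 (d := deg)) //.
  rewrite -(set_partition_big _ partP) /=.
  by apply: eq_bigl => v; rewrite inE.
have le1 : \sum_(c in P) \sum_(v in c) deg v <= s * \sum_(c in P) (#|c| - 1).
  by rewrite big_distrr; apply: leq_sum => c /classP[].
have le2 : s * \sum_(c in P) (#|c| - 1) <= s * (2 * nu).
  by rewrite leq_mul2l sumP orbT.
split; first by move: sum2 le1 le2; clear; lia.
move=> eE; exists P.
have e1 : \sum_(c in P) \sum_(v in c) deg v = s * (2 * nu).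
  by rewrite -sum2 eE; clear; lia.
have e2 : \sum_(c in P) (#|c| - 1) = 2 * nu.
  apply/eqP; rewrite eqn_leq sumP -(leq_pmul2l s0); by rewrite -e1.
split=> // c Pc; have [le eq] := classP c Pc; apply: eq.
apply/eqP; rewrite eqn_leq le leqNgt; apply/negP => lt.
suff : \sum_(c in P) \sum_(v in c) deg v < s * (2 * nu) by rewrite e1 ltnn.
rewrite -e2 big_distrr /= (bigD1 c) //= [X in _ < X](bigD1 c) //= -addSn.
by apply: leq_add => //; apply: leq_sum => c' /andP[/classP[]].
Qed.

(* Abbott, Hanson and Sauer.  A vertex covered by all maximum matchings can be
   deleted, which gives a strict inequality; without such vertices the classes
   of Gallai's relation are treated separately. *)
Lemma edges_degree_matching (T : finType) (s nu : nat) (E : {set {set T}}) :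
  {in E, forall D : {set T}, #|D| = 2} -> 0 < s ->
  (forall v, #|[set D in E | v \in D]| < s) ->
  (forall M : {set {set T}}, M \subset E -> trivIset M -> #|M| <= nu) ->
  #|E| <= s * nu /\
  (#|E| = s * nu -> exists P : {set {set T}}, [/\ partition P [set: T],
     {in E, forall D : {set T}, exists2 c, c \in P & D \subset c},
     {in P, forall c : {set T}, #|c| = 1 \/ #|c| = s} &
     \sum_(c in P) (#|c| - 1) = 2 * nu]).
Proof.
move=> + s0; elim: nu E => [|nu IH] E E2 degE maxE.
  (* For [nu = 0] the empty matching is maximum and misses every vertex. *)
  have m0 : maximum_matching E 0 set0.
    rewrite /maximum_matching sub0set cards0 eqxx andbT.
    by apply/trivIsetP => A B; rewrite inE.
  apply: (edges_missable E2 s0 degE maxE m0) => v; exists set0 => //.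
  by rewrite /cover big_set0 inE.
have strict : #|E| < s * nu.+1 -> #|E| <= s * nu.+1 /\
  (#|E| = s * nu.+1 -> exists P : {set {set T}}, [/\ partition P [set: T],
     {in E, forall D : {set T}, exists2 c, c \in P & D \subset c},
     {in P, forall c : {set T}, #|c| = 1 \/ #|c| = s} &
     \sum_(c in P) (#|c| - 1) = 2 * nu.+1]).
  by move=> lt; split; [apply: ltnW | move=> e; move: lt; rewrite e ltnn].
have [/existsP[M0 mM0]|/existsPn noM] := boolP [exists M, maximum_matching E nu.+1 M].
  have [/forallP missE|/forallPn[v /exists_inPn nv]] := boolP
      [forall v, [exists (M | maximum_matching E nu.+1 M), v \notin cover M]].
    by apply: (edges_missable E2 s0 degE maxE mM0) => v; apply/exists_inP.
  apply: strict; pose E' := [set D in E | v \notin D].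
  have sE' : E' \subset E by apply/subsetP => D; rewrite inE => /andP[].
  have cE : #|E| = #|[set D in E | v \in D]| + #|E'|.
    rewrite -(cardsID [set D : {set T} | v \in D] E).
    by congr (_ + _); apply: eq_card => D; rewrite !inE // andbC.
  have [|||leE' _] := IH E'.
  - by move=> D /(subsetP sE')/E2.
  - move=> w; apply: leq_ltn_trans (degE w); apply: subset_leq_card.
    by apply/subsetP => D; rewrite !inE => /andP[/andP[-> _] ->].
  - move=> M sM tM; have sME := subset_trans sM sE'.
    rewrite leqNgt; apply/negP => ltM.
    have := maxE M sME tM; rewrite leq_eqVlt ltnS [X in _ || X]leqNgt ltM orbF => eM.
    have mM : maximum_matching E nu.+1 M by rewrite /maximum_matching sME tM.
    have := nv M mM; rewrite negbK.
    case/bigcupP => D /(subsetP sM); rewrite inE => /andP[_ /negP nvD] vD.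
    exact: nvD.
  by rewrite cE mulnS -addSn; apply: leq_add (degE v) leE'.
(* No matching has [nu.+1] edges, so the induction hypothesis applies to [E] itself. *)
apply: strict; have [|leE _] := IH E E2 degE.
  move=> M sM tM; have := maxE M sM tM; rewrite leq_eqVlt ltnS.
  by have := noM M; rewrite /maximum_matching sM tM /= => /negbTE->.
by rewrite mulnS -[X in X < _]add0n -addSn; apply: leq_add.
Qed.

Lemma edges_bound (T : finType) (s nu : nat) (E : {set {set T}}) :
  {in E, forall D : {set T}, #|D| = 2} -> 0 < s ->
  (forall v, #|[set D in E | v \in D]| < s) ->
  (forall M : {set {set T}}, M \subset E -> trivIset M -> #|M| <= nu) ->
  #|E| <= s * nu.
Proof. by move=> E2 s0 dE mE; case: (edges_degree_matching E2 s0 dE mE). Qed.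

(** The sum of [#|c| - 1] is [2 * (s - 1)], so exactly two classes have size [s] and the others are
    single points. All edges lie in these two classes, and their number leaves no pair out. *)
Lemma edges_extremal (T : finType) (s : nat) (E : {set {set T}}) :
  {in E, forall D : {set T}, #|D| = 2} -> 1 < s ->
  (forall v, #|[set D in E | v \in D]| < s) ->
  (forall M : {set {set T}}, M \subset E -> trivIset M -> #|M| <= s - 1) ->
  #|E| = s * (s - 1) ->
  exists K1 K2 : {set T}, [/\ #|K1| = s, #|K2| = s, [disjoint K1 & K2] &
    E = ksubsets 2 K1 :|: ksubsets 2 K2].
Proof.
move=> E2 s1 dE mE cE; have s0 : 0 < s := ltnW s1.
have [_ /(_ cE)[P [partP PE Pc sumP]]] := edges_degree_matching E2 s0 dE mE.
pose Q := [set c in P | #|c| == s].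
have cQ : #|Q| = 2.
  have : \sum_(c in P) (#|c| - 1) = \sum_(c in Q) (s - 1).
    rewrite [LHS](bigID (fun c : {set T} => #|c| == s)) /=.
    rewrite [X in _ + X]big1 ?addn0; last first.
      by move=> c /andP[/Pc[->//|->]]; rewrite eqxx.
    rewrite [RHS](eq_bigl (fun c => (c \in P) && (#|c| == s))); last first.
      by move=> c; rewrite inE.
    by apply: eq_bigr => c /andP[_ /eqP->].
  rewrite sumP sum_nat_const => /eqP; rewrite eqn_pmul2r; last by rewrite subn_gt0.
  by move/eqP.
have /cards2P[K1 [K2 [neq eQ]]] : #|Q| == 2 by apply/eqP.
have [PK1 cK1] : K1 \in P /\ #|K1| = s.
  by have : K1 \in Q by [rewrite eQ !inE eqxx]; rewrite inE => /andP[? /eqP].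
have [PK2 cK2] : K2 \in P /\ #|K2| = s.
  by have : K2 \in Q by [rewrite eQ !inE eqxx orbT]; rewrite inE => /andP[? /eqP].
have dK : [disjoint K1 & K2].
  by case/and3P: partP => _ /trivIsetP tP _; apply: tP.
exists K1, K2; split=> //.
have sE : E \subset ksubsets 2 K1 :|: ksubsets 2 K2.
  apply/subsetP => D ED; have [c cP sDc] := PE _ ED.
  have : c \in Q.
    rewrite inE cP /=; case: (Pc _ cP) => [c1|->//].
    by have := subset_leq_card sDc; rewrite E2 // c1.
  by rewrite eQ !inE E2 // => /orP[/eqP<-|/eqP<-]; rewrite sDc ?orbT.
apply/eqP; rewrite eqEcard sE /= cE.
apply: leq_trans (leq_card_setU _ _) _; rewrite !card_ksubsets cK1 cK2.
rewrite addnn bin2 halfK subn1; exact: leq_subr.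
Qed.

(** * The two-clique family *)

Definition two_clique_family (T : finType) (k : nat) (K1 K2 : {set T}) :
    {set {set T}} :=
  [set A in ksubsets k [set: T] |
     [&& 2 <= #|A :&: (K1 :|: K2)|, #|A :&: K1| != 1 & #|A :&: K2| != 1]].

Section TwoCliques.
Variables (T : finType) (s : nat) (K1 K2 : {set T}).
Hypotheses (s_odd : odd s) (s_gt1 : 1 < s).
Hypotheses (cK1 : #|K1| = s) (cK2 : #|K2| = s) (dK : [disjoint K1 & K2]).

(** If [x] were in [K], each of the [s] petals would need a further point of [K], all distinct, but
    only [s - 1] are left. *)
Lemma sunflower_center_notin (x : T) (S : {set {set T}}) (K : {set T}) :
  #|S| = s -> meets_in [set x] S -> #|K| = s ->
  {in S, forall A : {set T}, #|A :&: K| != 1} -> x \notin K.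
Proof.
move=> cS mS cK hS; apply/negP => xK.
have dW : [disjoint K :\ x & [set x]].
  by rewrite -setI_eq0 setIDAC -setIDA setDv setI0.
have := meets_in_sum mS dW.
have cKx : #|K :\ x|.+1 = s by have := cardsD1 x K; rewrite xK cK add1n => <-.
suff : s <= \sum_(A in S) #|A :&: (K :\ x)|.
  by rewrite -[in X in X -> _]cKx => /leq_trans h /h; rewrite ltnn.
rewrite -cS -sum1_card; apply: leq_sum => A SA.
have xA : x \in A.
  by rewrite -sub1set; apply: meets_in_sub SA; rewrite ?cS.
have := hS _ SA; have := cardsD1 x (A :&: K); rewrite inE xA xK setIDA.
by move: #|_| #|_| => a b; clear; lia.
Qed.

(** A petal meeting [K] uses two points of [K] of its own. As [s] is odd, one point is left over,
    and for two cliques this gains a whole petal. *)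
Lemma sum_petals_half (x : T) (S : {set {set T}}) (K : {set T}) :
  meets_in [set x] S -> #|K| = s -> x \notin K ->
  {in S, forall A : {set T}, #|A :&: K| != 1} ->
  \sum_(A in S) (0 < #|A :&: K|) * 2 <= s - 1.
Proof.
move=> mS cK xK hS.
have dW : [disjoint K & [set x]].
  by rewrite disjoint_sym disjoints1.
have : \sum_(A in S) (0 < #|A :&: K|) * 2 <= s.
  rewrite -cK; apply: leq_trans (meets_in_sum mS dW).
  by apply: leq_sum => A /hS; case: #|_| => [|[|a]].
rewrite -big_distrl /=; move: (\sum_(_ in _) _) => a.
by move: s_odd; clear; lia.
Qed.

Lemma two_clique_free k : ~ contains_sunflower s 1 (two_clique_family k K1 K2).
Proof.
case=> S [sS [cS mS] /eqP/cards1P[x ex]].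
have {}mS : meets_in [set x] S.
  by apply/meets_inP => A B SA SB neq; rewrite mS.
have h A : A \in S -> [/\ 2 <= #|A :&: (K1 :|: K2)|, #|A :&: K1| != 1 & #|A :&: K2| != 1].
  by move=> /(subsetP sS); rewrite inE => /andP[_ /and3P[]].
have h1 : {in S, forall A : {set T}, #|A :&: K1| != 1} by move=> A /h[].
have h2 : {in S, forall A : {set T}, #|A :&: K2| != 1} by move=> A /h[].
have x1 := sunflower_center_notin cS mS cK1 h1.
have x2 := sunflower_center_notin cS mS cK2 h2.
have s1 := sum_petals_half mS cK1 x1 h1.
have s2 := sum_petals_half mS cK2 x2 h2.
have := leq_add s1 s2; rewrite -big_split /=.
(* Every petal meets one of the cliques, while the two bounds add up to [2 * (s - 1)] only. *)
suff : s * 2 <= \sum_(A in S) ((0 < #|A :&: K1|) * 2 + (0 < #|A :&: K2|) * 2).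
  by move: (\sum_(_ in _) _) => a; move: s_gt1; clear; lia.
rewrite -cS -sum_nat_const; apply: leq_sum => A /h[+ _ _].
rewrite setIUr => /leq_trans/(_ (leq_card_setU _ _)).
by move: #|_| #|_| => a b; clear; case: a => //; case: b.
Qed.

Lemma card_setU_prod (V : {set T}) (P Q : {set {set T}}) :
  {in P, forall D : {set T}, D \subset V} ->
  {in Q, forall S : {set T}, [disjoint S & V]} ->
  #|[set X.1 :|: X.2 | X in setX P Q]| = #|P| * #|Q|.
Proof.
move=> hP hQ; rewrite -cardsX; apply: card_in_imset.
move=> [D S] [D' S']; rewrite !inE /= => /andP[PD QS] /andP[PD' QS'] e.
have key (X Y : {set T}) : X \subset V -> [disjoint Y & V] ->
    (X :|: Y) :&: V = X /\ (X :|: Y) :\: V = Y.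
  move=> sX dY; rewrite setIUl setDUl (setIidPl sX) (disjoint_setI0 dY) setU0.
  by move: sX; rewrite -setD_eq0 => /eqP->; rewrite set0U (setDidPl dY).
have [e1 e2] := key _ _ (hP _ PD) (hQ _ QS).
have [e1' e2'] := key _ _ (hP _ PD') (hQ _ QS').
by congr pair; [rewrite -e1 e e1' | rewrite -e2 e e2'].
Qed.

Let V := K1 :|: K2.

Lemma card_V : #|V| = 2 * s.
Proof. by rewrite cardsU (disjoint_setI0 dK) cards0 subn0 cK1 cK2 addnn mul2n. Qed.

Lemma clique_pairs_card : #|ksubsets 2 K1 :|: ksubsets 2 K2| = s * (s - 1).
Proof.
have d : [disjoint ksubsets 2 K1 & ksubsets 2 K2].
  rewrite -setI_eq0; apply/eqP/setP => D; rewrite !inE; apply/negbTE.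
  apply/negP => /andP[/andP[s1 /eqP c] /andP[s2 _]].
  have : D \subset K1 :&: K2 by rewrite subsetI s1.
  by rewrite (disjoint_setI0 dK) subset0 => /eqP e; rewrite e cards0 in c.
rewrite cardsU (disjoint_setI0 d) cards0 subn0 !card_ksubsets cK1 cK2.
rewrite bin2 addnn halfK subn1 oddM; case: s s_odd => // s' /= /negbTE->.
by rewrite andbF subn0.
Qed.

Lemma clique_pair_sub (D : {set T}) : D \in ksubsets 2 K1 :|: ksubsets 2 K2 ->
  D \subset V /\ #|D| = 2.
Proof.
rewrite !inE => /orP[|] /andP[sD /eqP->]; split=> //;
  apply: subset_trans sD _; [exact: subsetUl | exact: subsetUr].
Qed.

Lemma clique_pair_union_in k (D S : {set T}) : D \in ksubsets 2 K1 :|: ksubsets 2 K2 ->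
  [disjoint S & V] -> #|D :|: S| = k -> D :|: S \in two_clique_family k K1 K2.
Proof.
move=> hD dS cDS; have [sDV cD] := clique_pair_sub hD.
rewrite !inE subsetT cDS eqxx /=.
have e (X : {set T}) : X \subset V -> (D :|: S) :&: X = D :&: X.
  move=> sX; rewrite setIUl; suff -> : S :&: X = set0 by rewrite setU0.
  by apply/disjoint_setI0; apply: disjointWr dS.
rewrite !e ?subsetUl ?subsetUr // (setIidPl sDV) cD /=.
have d12 (X Y : {set T}) : [disjoint X & Y] -> D \subset X -> D :&: X = D /\ D :&: Y = set0.
  move=> dXY sD; rewrite (setIidPl sD); split=> //.
  by apply/disjoint_setI0; apply: disjointWl dXY.
move: hD; rewrite !inE => /orP[|] /andP[sD _].
  by have [-> ->] := d12 _ _ dK sD; rewrite cD cards0.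
by have [|-> ->] := d12 K2 K1 _ sD; rewrite ?cD ?cards0 // disjoint_sym.
Qed.

(** Only the members formed by one clique pair and [k - 2] points off the cliques are counted; they
    give the leading term. *)
Lemma two_clique_card k : 2 <= k ->
  s * (s - 1) * 'C(#|T| - 2 * s, k - 2) <= #|two_clique_family k K1 K2|.
Proof.
move=> k2; have cV : #|~: V| = #|T| - 2 * s by rewrite cardsCs setCK card_V.
rewrite -clique_pairs_card -cV -card_ksubsets -(@card_setU_prod V).
- apply: subset_leq_card; apply/subsetP => A /imsetP[[D S]].
  rewrite inE /= => /andP[hD]; rewrite inE => /andP[sS /eqP cS] ->.
  have dS : [disjoint S & V] by rewrite disjoints_subset.
  apply: clique_pair_union_in => //; have [sDV cD] := clique_pair_sub hD.
  rewrite cardsU cD cS (_ : D :&: S = set0) ?cards0; first by move: k2; clear; lia.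
  by rewrite setIC; apply/disjoint_setI0; apply: disjointWr dS.
- by move=> D /clique_pair_sub[].
- by move=> S; rewrite inE => /andP[sS _]; rewrite disjoints_subset.
Qed.

Lemma two_clique_link_card k (D : {set T}) (x : T) : 3 <= k ->
  D \in ksubsets 2 K1 :|: ksubsets 2 K2 -> x \notin V ->
  'C(#|T| - (2 * s).+1, k - 3) <=
    #|[set A in two_clique_family k K1 K2 | x |: D \subset A]|.
Proof.
move=> k3 hD xV; have [sDV cD] := clique_pair_sub hD.
have cV : #|~: (x |: V)| = #|T| - (2 * s).+1.
  by rewrite cardsCs setCK cardsU1 xV card_V.
rewrite -cV -card_ksubsets -[X in X <= _]mul1n -[X in X * _](cards1 (x |: D)).
rewrite -(@card_setU_prod (x |: V)).
- apply: subset_leq_card; apply/subsetP => A /imsetP[[D' S] /setXP[/= /set1P-> hS] ->].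
  have /andP[sS /eqP cS] : (S \subset ~: (x |: V)) && (#|S| == k - 3).
    by move: hS; rewrite inE.
  have dS : [disjoint S & x |: V] by rewrite disjoints_subset.
  have e : x |: D :|: S = D :|: (x |: S) by rewrite setUCA setUA.
  have : x |: D :|: S \in two_clique_family k K1 K2; last first.
    by move=> h; apply/setIdP; split; rewrite ?subsetUl.
  have xD : x \notin D by apply: contra xV => /(subsetP sDV).
  have cDS : #|x |: D :|: S| = k.
    rewrite cardsU cardsU1 xD cD cS (_ : _ :&: S = set0) ?cards0; first by move: k3; clear; lia.
    rewrite setIC; apply/disjoint_setI0; apply: disjointWr dS.
    by apply: setUS.
  rewrite e; apply: clique_pair_union_in => //; last by rewrite -e.
  rewrite -setI_eq0 setIUl setU_eq0 !setI_eq0 disjoints1 xV /=.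
  by apply: disjointWr dS; apply: subsetUr.
- by move=> D'; rewrite inE => /eqP->; apply: setUS.
- by move=> S; rewrite inE => /andP[sS _]; rewrite disjoints_subset.
Qed.

End TwoCliques.

(** * Counting estimates for links, powers and binomial coefficients *)

Lemma card_supersets (T : finType) (k : nat) (B : {set T}) (F : {set {set T}}) :
  {in F, forall A : {set T}, #|A| = k /\ B \subset A} -> #|F| <= 'C(#|T|, k - #|B|).
Proof.
move=> hF; have inj : {in F &, injective (fun A => A :\: B)}.
  move=> A A' /hF[_ sA] /hF[_ sA'] e.
  by rewrite -(setID A B) -(setID A' B) e (setIidPr sA) (setIidPr sA').
rewrite -(card_in_imset inj) -(card_draws T); apply: subset_leq_card.
apply/subsetP => _ /imsetP[A /hF[cA sA] ->]; rewrite inE.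
by rewrite cardsD (setIidPr sA) cA.
Qed.

Lemma card_link_nonkernel (T : finType) (q k : nat) (B : {set T}) (F : {set {set T}}) :
  {in F, forall A : {set T}, #|A| = k} -> #|B| < k -> 0 < q -> ~~ kernel q F B ->
  #|[set A in F | B \subset A]| <= q * k * 'C(#|T|, k - #|B|.+1).
Proof.
move=> F_unif Bk q0 nk; have [Y [cY dY hY]] := link_cover F_unif Bk q0 nk.
apply: leq_trans (_ : \sum_(y in Y) 'C(#|T|, k - #|B|.+1) <= _); last first.
  by rewrite sum_nat_const leq_mul2r cY orbT.
apply: leq_trans (_ : \sum_(y in Y) #|[set A in F | y |: B \subset A]| <= _).
  apply: leq_trans (card_bigcup_leq _ _); apply: subset_leq_card.
  apply/subsetP => A; rewrite inE => /andP[FA sBA]; have [y Yy yA] := hY _ FA sBA.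
  by apply/bigcupP; exists y => //; rewrite inE FA subUset sub1set yA.
apply: leq_sum => y Yy; have -> : #|B|.+1 = #|y |: B|.
  by rewrite cardsU1 (disjointFr dY Yy).
by apply: card_supersets => A; rewrite inE => /andP[/F_unif].
Qed.

(** The shifted falling factorial has leading term [n ^ j.+1]. The error is added on the right, so
    the bound also holds for [n < t], where [n - t] is 0. *)
Lemma expn_leq_ffact (t j : nat) :
  exists C, forall n, n ^ j.+1 <= (n - t) ^_ j.+1 + C * n ^ j.
Proof.
elim: j => [|j [C IH]].
  by exists t => n; rewrite ffactn1 expn1 expn0 muln1; lia.
exists (C + (t + j.+1)) => n; rewrite ffactnSr.
have h1 : n <= (n - t - j.+1) + (t + j.+1) by lia.
rewrite expnSr; apply: leq_trans (leq_mul (leqnn _) h1) _.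
rewrite mulnDr mulnDl addnA; apply: leq_add; last by rewrite mulnC.
apply: leq_trans (leq_mul (IH n) (leqnn _)) _.
rewrite mulnDl leq_add2l -mulnA leq_mul2l; apply/orP; right.
rewrite expnSr leq_mul2l; apply/orP; right.
by rewrite -subnDA leq_subr.
Qed.

Lemma ffact_leq_expn n j : n ^_ j <= n ^ j.
Proof.
elim: j => [|j IH]; first by rewrite ffactn0.
by rewrite ffactnSr expnSr leq_mul // leq_subr.
Qed.

Lemma bin_leq_expn n j : 'C(n, j) <= n ^ j.
Proof.
apply: leq_trans (ffact_leq_expn n j); rewrite -bin_ffact.
by rewrite leq_pmulr // fact_gt0.
Qed.

(** * The graph of kernel pairs *)

Section KernelGraph.
Variables (T : finType) (s k : nat) (F : {set {set T}}).
Hypotheses (s_gt1 : 1 < s) (k_ge5 : 5 <= k).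
Hypothesis F_unif : {in F, forall A : {set T}, #|A| = k}.
Hypothesis F_free : ~ contains_sunflower s 1 F.

Let k_gt1 : 1 < k. Proof. exact: leq_trans k_ge5. Qed.

Definition kernel_pairs : {set {set T}} :=
  [set D : {set T} | (#|D| == 2) && kernel (s * k) F D].

Definition extensions (D : {set T}) : {set T} :=
  [set x | (x \notin D) && kernel (s * k) F (x |: D)].

Lemma kernel_pairs2 : {in kernel_pairs, forall D : {set T}, #|D| = 2}.
Proof. by move=> D; rewrite inE => /andP[/eqP]. Qed.

Lemma kernel_pairs_degree v : #|[set D in kernel_pairs | v \in D]| < s.
Proof.
rewrite ltnNge; apply/negP => h.
apply: (no_kernel_sunflower s_gt1 k_gt1 F_unif F_free h (x := v)).
  by apply: meets_in_pairs => D; rewrite !inE => /andP[/andP[/eqP-> _] ->].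
by move=> D; rewrite !inE => /andP[/andP[/eqP-> ->] _]; rewrite orbT.
Qed.

Lemma kernel_pairs_matching (x : T) (M : {set {set T}}) :
  M \subset kernel_pairs -> trivIset M ->
  {in M, forall D : {set T}, x \in extensions D} -> #|M| < s.
Proof.
move=> sM /trivIsetP tM hM; have xM D : D \in M -> x \notin D.
  by move=> /hM; rewrite inE => /andP[].
have inj : {in M &, injective (fun D => x |: D)}.
  move=> D D' /xM xD /xM xD' /(congr1 (fun X => X :\ x)).
  by rewrite !setU1K.
rewrite -(card_in_imset inj) ltnNge; apply/negP => h.
apply: (no_kernel_sunflower s_gt1 k_gt1 F_unif F_free h (x := x)).
  apply/meets_inP => _ _ /imsetP[D MD ->] /imsetP[D' MD' ->] neq.
  have /tM dD : D != D' by apply: contraNneq neq => ->.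
  by rewrite -setUIr disjoint_setI0 ?dD // setU0.
move=> _ /imsetP[D MD ->]; rewrite cardsU1 (xM _ MD) kernel_pairs2 ?(subsetP sM) //.
by have := hM _ MD; rewrite inE => /andP[_ ->]; rewrite orbT.
Qed.

(** Double counting: for each [x] the kernel pairs extended by [x] have degrees below [s] and no
    matching of size [s], hence number at most [s * (s - 1)]. *)
Lemma sum_extensions :
  \sum_(D in kernel_pairs) #|extensions D| <= s * (s - 1) * #|T|.
Proof.
have -> : \sum_(D in kernel_pairs) #|extensions D| =
    \sum_(x : T) #|[set D in kernel_pairs | x \in extensions D]|.
  rewrite (eq_bigr (fun D => \sum_(x : T) (x \in extensions D))); last first.
    move=> D _; rewrite -sum1_card [LHS]big_mkcond /=.
    by apply: eq_bigr => x _; case: (x \in extensions D).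
  rewrite exchange_big /=; apply: eq_bigr => x _.
  rewrite -sum1_card [LHS]big_mkcond [RHS]big_mkcond /=.
  apply: eq_bigr => D _; rewrite [in RHS]inE.
  by case: (D \in kernel_pairs); case: (x \in extensions D).
rewrite [X in _ <= X]mulnC -sum_nat_const; apply: leq_sum => x _.
have sH : [set D in kernel_pairs | x \in extensions D] \subset kernel_pairs.
  by apply/subsetP => D; rewrite inE => /andP[].
apply: edges_bound.
- by move=> D /(subsetP sH)/kernel_pairs2.
- exact: ltnW.
- move=> v; apply: leq_ltn_trans (kernel_pairs_degree v).
  by apply/subset_leq_card/subsetP => D /setIdP[/(subsetP sH) h vD]; apply/setIdP.
- move=> M sM tM; rewrite subn1 -ltnS prednK ?(ltnW s_gt1) //.
  apply: (@kernel_pairs_matching x) => //; first exact: subset_trans sH.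
  by move=> D /(subsetP sM)/setIdP[].
Qed.

(** A member anchored at [D] is [D] together with [k - 2] points of [extensions D]. *)
Lemma card_anchored :
  #|F| <= (s * k * k) ^ 2 ^ k * 'C(#|T|, k - 3) +
          \sum_(D in kernel_pairs) 'C(#|extensions D|, k - 2).
Proof.
pose R := [set A in F | ~~ [exists D, anchored (s * k) F A D]].
pose X D : {set {set T}} := [set D :|: S | S in ksubsets (k - 2) (extensions D)].
have sF : F \subset R :|: \bigcup_(D in kernel_pairs) X D.
  apply/subsetP => A FA; rewrite in_setU; have [//|] := boolP (A \in R).
  rewrite inE FA /= negbK => /existsP[D /and4P[sDA cD kD /forall_inP hD]].
  apply/bigcupP; exists D; first by rewrite inE cD.
  apply/imsetP; exists (A :\: D).
    rewrite inE cardsD (setIidPr sDA) (F_unif FA) (eqP cD) eqxx andbT.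
    apply/subsetP => x xA; rewrite inE hD // andbT.
    by move: xA; rewrite inE => /andP[].
  by rewrite -[LHS](setID A D) (setIidPr sDA).
apply: leq_trans (subset_leq_card sF) _.
apply: leq_trans (leq_card_setU _ _) _; apply: leq_add.
  exact: card_unanchored.
apply: leq_trans (card_bigcup_leq _ _) _; apply: leq_sum => D _.
by apply: leq_trans (leq_imset_card _ _) _; rewrite card_ksubsets.
Qed.

End KernelGraph.

(** * Stability: kernel pairs with almost all extensions form two cliques *)

(** The two sum conditions bound the sum [X] of [a i * (n - a i)] by [C * n], so a large [a i] is
    within [2 * C] of [n]. The small ones add up to at most [2 * C]; the large ones thus sum to at
    least [m * n - 3 * C], and there are at least [m] of them. *)
Lemma sum_square_stability (I : finType) (P : {set I}) (a : I -> nat) (m n C : nat) :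
  3 * C < n -> (forall i, a i <= n) -> \sum_(i in P) a i <= m * n ->
  m * n ^ 2 <= \sum_(i in P) a i ^ 2 + C * n ->
  m <= #|[set i in P | n <= 2 * a i]| /\
  {in P, forall i, n <= 2 * a i -> n - a i <= 2 * C}.
Proof.
move=> ltn an sum1 sum2.
have n0 : 0 < n by apply: leq_ltn_trans ltn.
pose X := \sum_(i in P) a i * (n - a i).
have eX : n * \sum_(i in P) a i = \sum_(i in P) a i ^ 2 + X.
  rewrite big_distrr /X -big_split /=; apply: eq_bigr => i _.
  by have := an i; rewrite -mulnDr; move=> h; rewrite mulnC; congr (_ * _); lia.
have leX : X <= C * n.
  move: eX sum1 sum2; move: X (\sum_(_ in _) _) (\sum_(_ in _) _ ^ 2).
  by clear; nia.
have large i : i \in P -> n <= 2 * a i -> n - a i <= 2 * C.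
  move=> Pi hi; have : a i * (n - a i) <= X by rewrite /X (bigD1 i) //= leq_addr.
  by move: (an i) hi leX n0; move: (a i) (X); clear; nia.
split=> //.
set L := [set i in P | n <= 2 * a i].
have sumL : \sum_(i in L) a i <= #|L| * n.
  by rewrite -sum_nat_const; apply: leq_sum.
have small : n * \sum_(i in P | ~~ (n <= 2 * a i)) a i <= 2 * X.
  apply: leq_trans (_ : 2 * \sum_(i in P | ~~ (n <= 2 * a i)) a i * (n - a i) <= _).
    rewrite !big_distrr /=; apply: leq_sum => i /andP[_]; rewrite -ltnNge.
    by move: (a i) => b; clear; nia.
  rewrite leq_mul2l /X [X in _ <= X](bigID (fun i => n <= 2 * a i)) /=.
  exact: leq_addl.
have split1 : \sum_(i in P) a i =
    \sum_(i in L) a i + \sum_(i in P | ~~ (n <= 2 * a i)) a i.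
  rewrite (bigID (fun i => n <= 2 * a i)) /=; congr (_ + _).
  by apply: eq_bigl => i; rewrite inE.
move: split1 small sumL eX leX sum2 n0 ltn.
move: (\sum_(i in P | ~~ _) _) (\sum_(i in L) _) (\sum_(i in P) a i) X.
move: (\sum_(i in P) _ ^ 2) #|L|; clear.
move=> S2 l x3 x2 x1 X e1 h1 h2 e2 h3 h4 n0 h5.
have h6 : x3 <= 2 * C by nia.
have h7 : m * n <= x1 + C by nia.
have h8 : m * n < l.+1 * n by nia.
by move: h8; rewrite ltn_pmul2r.
Qed.

Lemma kernel_cliques (s k : nat) : odd s -> 1 < s -> 5 <= k ->
  exists C n1, forall (T : finType) (F : {set {set T}}),
  n1 <= #|T| -> {in F, forall A : {set T}, #|A| = k} ->
  ~ contains_sunflower s 1 F ->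
  s * (s - 1) * 'C(#|T| - 2 * s, k - 2) <= #|F| ->
  exists K1 K2 : {set T}, [/\ #|K1| = s, #|K2| = s, [disjoint K1 & K2],
    {in ksubsets 2 K1 :|: ksubsets 2 K2, forall D : {set T},
       kernel (s * k) F D /\ #|~: extensions s k F D| <= C} &
    exists M : {set {set T}}, [/\ M \subset ksubsets 2 K1 :|: ksubsets 2 K2,
       trivIset M & #|M| = s - 1]].
Proof.
move=> s_odd s1 k5.
have [C0 hC0] := expn_leq_ffact (2 * s) (k - 3).
pose w := (k - 2)`!; pose m := s * (s - 1).
(* The first term comes from the unanchored members, the second from replacing a falling factorial
   by a power. *)
pose C2 := w * (s * k * k) ^ 2 ^ k + m * C0.
(* Stability needs [3 * C2 < n]; a common extension of [s] pairs needs [s * (2 * C2) < n]. *)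
exists (2 * C2), ((3 * C2 + s * (2 * C2)).+1) => T F le_n F_unif F_free leF.
set n := #|T| in le_n leF *.
pose H := kernel_pairs s k F; pose N := extensions s k F.
have n0 : 0 < n by apply: leq_ltn_trans le_n.
have ek2 : (k - 3).+1 = k - 2 by lia.
have ek3 : (k - 4).+1 = k - 3 by lia.
rewrite ek2 in hC0.
have Nn D : #|N D| <= n by apply: max_card.
(* Multiply by [n ^ (k - 4)] and compare both bounds on [#|F|], using that [#|N D| ^ (k - 2)] is at
   most [#|N D| ^ 2 * n ^ (k - 4)]. *)
have key : m * n ^ 2 <= \sum_(D in H) #|N D| ^ 2 + C2 * n.
  rewrite -(@leq_pmul2r (n ^ (k - 4))) ?expn_gt0 ?n0 //.
  have e1 : m * n ^ 2 * n ^ (k - 4) = m * n ^ (k - 2).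
    by rewrite -mulnA -expnD; congr (_ * _ ^ _); lia.
  have h1 : m * n ^ (k - 2) <= w * #|F| + m * C0 * n ^ (k - 3).
    apply: leq_trans (leq_mul (leqnn m) (hC0 n)) _.
    rewrite mulnDr mulnA leq_add2r -bin_ffact mulnA mulnC leq_mul2l.
    by rewrite leF orbT.
  have h2 : w * #|F| <= w * (s * k * k) ^ 2 ^ k * n ^ (k - 3) +
      (\sum_(D in H) #|N D| ^ 2) * n ^ (k - 4).
    apply: leq_trans (leq_mul (leqnn w) (card_anchored s1 k5 F_unif F_free)) _.
    rewrite mulnDr; apply: leq_add.
      by rewrite mulnA leq_mul2l bin_leq_expn orbT.
    rewrite big_distrr big_distrl /=; apply: leq_sum => D _.
    rewrite mulnC bin_ffact; apply: leq_trans (ffact_leq_expn _ _) _.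
    have -> : k - 2 = 2 + (k - 4) by lia.
    by rewrite expnD leq_mul2l leq_exp2r ?Nn ?orbT // subn_gt0.
  rewrite e1; apply: leq_trans h1 _.
  apply: leq_trans (leq_add h2 (leqnn _)) _.
  rewrite -ek3 expnSr /C2; move: (n ^ (k - 4)) (\sum_(_ in _) _) (w * _) (m * _).
  by clear; move=> *; lia.
have sumN : \sum_(D in H) #|N D| <= m * n := sum_extensions s1 k5 F_unif F_free.
have [|lem hL] := sum_square_stability _ Nn sumN key; first by lia.
set L := [set D in H | _] in lem.
have sLH : L \subset H by apply/subsetP => D /setIdP[].
have L2 : {in L, forall D : {set T}, #|D| = 2}.
  by move=> D /(subsetP sLH)/kernel_pairs2.
have Ldeg v : #|[set D in L | v \in D]| < s.
  apply: leq_ltn_trans (kernel_pairs_degree s1 k5 F_unif F_free v).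
  by apply/subset_leq_card/subsetP => D /setIdP[/(subsetP sLH) h vD]; apply/setIdP.
have cN D : D \in L -> #|~: N D| <= 2 * C2.
  by move=> /setIdP[HD h]; rewrite cardsCs setCK; apply: hL.
(* Among [s] disjoint pairs of [L], each fails to extend by at most [2 * C2] points, so some [x]
   extends them all, contradicting [kernel_pairs_matching]. *)
have Lmat (M : {set {set T}}) : M \subset L -> trivIset M -> #|M| <= s - 1.
  move=> sM tM; rewrite leqNgt; apply/negP => lt.
  have [|M' [_ sM' cM']] := @subset_of_card _ s set0 M (sub0set _).
    by rewrite cards0; lia.
  have sM'L := subset_trans sM' sM; have tM' := trivIsetS sM' tM.
  have [x xY] : exists x, x \notin \bigcup_(D in M') ~: N D.
    have : 0 < #|~: \bigcup_(D in M') ~: N D|.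
      rewrite cardsCs setCK subn_gt0; apply: leq_ltn_trans (card_bigcup_leq _ _) _.
      apply: (@leq_ltn_trans (\sum_(D in M') 2 * C2)).
        by apply: leq_sum => D /(subsetP sM'L)/cN.
      by rewrite sum_nat_const cM'; move: le_n; rewrite -/n; lia.
    by case/card_gt0P => x; rewrite inE; exists x.
  suff : #|M'| < s by rewrite cM' ltnn.
  apply: (@kernel_pairs_matching _ s k F s1 k5 F_unif F_free x) => //.
    exact: subset_trans sLH.
  move=> D MD; move: xY; apply: contraNT => xN; apply/bigcupP; exists D => //.
  by rewrite inE.
have s0 : 0 < s := ltnW s1.
have leL : #|L| <= m := edges_bound L2 s0 Ldeg Lmat.
have cL : #|L| = m by apply/eqP; rewrite eqn_leq leL lem.
have [K1 [K2 [cK1 cK2 dK eL]]] := edges_extremal L2 s1 Ldeg Lmat cL.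
exists K1, K2; rewrite -eL; split=> //.
  by move=> D LD; split; [move: (subsetP sLH _ LD); rewrite inE => /andP[] | apply: cN].
have [/existsP[M /and3P[sM tM /eqP cM]]|/existsPn noM] := boolP
    [exists M : {set {set T}}, [&& M \subset L, trivIset M & #|M| == s - 1]].
  by exists M.
(* Without a matching of size [s - 1] the edge bound would apply with [s - 2]. *)
have : #|L| <= s * (s - 2).
  apply: edges_bound => // M sM tM; have := Lmat M sM tM.
  have := noM M; rewrite sM tM /= => /negbTE neM; rewrite leq_eqVlt neM /=.
  by move: s1; clear; lia.
rewrite cL leq_mul2l => /orP[/eqP e|]; first by rewrite e in s0.
by move: s1; clear; lia.
Qed.

(** * Exactness *)

Section Exactness.
Variables (T : finType) (s k : nat) (F : {set {set T}}).
Hypotheses (s_gt1 : 1 < s) (k_ge5 : 5 <= k).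
Hypothesis F_unif : {in F, forall A : {set T}, #|A| = k}.
Hypothesis F_free : ~ contains_sunflower s 1 F.

Let k_gt1 : 1 < k. Proof. exact: leq_trans k_ge5. Qed.

Lemma card_member_clique (K A : {set T}) : #|K| = s ->
  {in ksubsets 2 K, forall D : {set T}, kernel (s * k) F D} ->
  A \in F -> #|A :&: K| != 1.
Proof.
move=> cK kK FA; apply/negP => /cards1P[x eAK].
have [xA xK] : x \in A /\ x \in K.
  by apply/andP; rewrite -in_setI eAK inE.
pose S := [set [set x; y] | y in K :\ x].
have hS D : D \in S -> [/\ #|D| = 2, x \in D & D \subset K].
  move=> /imsetP[y]; rewrite !inE => /andP[nyx yK] ->; split.
  - by rewrite cards2 eq_sym nyx.
  - by rewrite set21.
  - by rewrite subUset !sub1set xK.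
have AS : A \notin S by apply/negP => /hS[]; rewrite F_unif // => e; move: k_ge5; rewrite e.
have cS : #|A |: S| = s.
  rewrite cardsU1 AS /= card_in_imset.
    by have := cardsD1 x K; rewrite xK cK => ->.
  move=> y z; rewrite !inE => /andP[nyx _] _ e.
  have : y \in [set x; z] by rewrite -e set22.
  by rewrite !inE (negbTE nyx) => /eqP.
apply: (no_kernel_sunflower s_gt1 k_gt1 F_unif F_free (S := A |: S) (x := x)).
- by rewrite cS.
- apply: meets_inU1; last by apply: meets_in_pairs => D /hS[].
  move=> D /hS[_ xD sDK]; apply/eqP; rewrite eqEsubset -{1}eAK setIS //=.
  by rewrite sub1set inE xA.
- move=> D; rewrite in_setU1 => /orP[/eqP->|SD]; first by rewrite F_unif // FA.
  have [cD _ sDK] := hS _ SD; rewrite cD kK ?orbT //.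
  by rewrite inE sDK cD.
Qed.

(** If [x] were in [A], then [A] and the [s - 1] sets [x |: D] would be the petals of a sunflower
    with core [[set x]]. *)
Lemma member_off_cliques (V A : {set T}) (M : {set {set T}}) (x : T) :
  A \in F -> [disjoint A & V] -> trivIset M -> #|M| = s - 1 ->
  {in M, forall D : {set T}, D \subset V /\ #|D| = 2} ->
  {in M, forall D : {set T}, x \in extensions s k F D} -> x \notin A.
Proof.
move=> FA dAV /trivIsetP tM cM hM xM; apply/negP => xA.
have xD D : D \in M -> x \notin D by move=> /xM; rewrite inE => /andP[].
pose S := [set x |: D | D in M].
have AS : A \notin S.
  apply/negP => /imsetP[D MD] eA; have := F_unif FA; rewrite eA.
  by rewrite cardsU1 xD // (hM _ MD).2 => e; move: k_ge5; rewrite -e.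
have cS : #|A |: S| = s.
  rewrite cardsU1 AS /= card_in_imset ?cM ?subnKC ?(ltnW s_gt1) //.
  move=> D D' /xD nD /xD nD' /(congr1 (fun X => X :\ x)).
  by rewrite !setU1K.
apply: (no_kernel_sunflower s_gt1 k_gt1 F_unif F_free (S := A |: S) (x := x)).
- by rewrite cS.
- apply: meets_inU1.
    move=> _ /imsetP[D MD ->]; rewrite setIUr.
    have -> : A :&: D = set0.
      by apply/disjoint_setI0; apply: disjointWr dAV; case: (hM _ MD).
    by rewrite setU0; apply/setIidPr; rewrite sub1set.
  apply/meets_inP => _ _ /imsetP[D MD ->] /imsetP[D' MD' ->] neq.
  have /tM dD : D != D' by apply: contraNneq neq => ->.
  by rewrite -setUIr disjoint_setI0 ?dD // setU0.
- move=> D; rewrite in_setU1 => /orP[/eqP->|/imsetP[D' MD' ->]].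
    by rewrite F_unif // FA.
  rewrite cardsU1 xD // (hM _ MD').2; split=> //.
  by have := xM _ MD'; rewrite inE => /andP[_ ->]; rewrite orbT.
Qed.

End Exactness.

Lemma sub_two_clique_family (s k : nat) : odd s -> 1 < s -> 5 <= k ->
  exists n0, forall (T : finType) (F : {set {set T}}),
  n0 <= #|T| -> {in F, forall A : {set T}, #|A| = k} ->
  ~ contains_sunflower s 1 F ->
  s * (s - 1) * 'C(#|T| - 2 * s, k - 2) <= #|F| ->
  (forall K1 K2 : {set T}, #|K1| = s -> #|K2| = s -> [disjoint K1 & K2] ->
     #|two_clique_family k K1 K2| <= #|F|) ->
  exists K1 K2 : {set T}, [/\ #|K1| = s, #|K2| = s, [disjoint K1 & K2] &
    F \subset two_clique_family k K1 K2].
Proof.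
move=> s_odd s1 k5.
have [C [n1 hC]] := kernel_cliques s_odd s1 k5.
have [C0 hC0] := expn_leq_ffact (2 * s).+1 (k - 4).
(* [b] bounds the number of members off the cliques: all are subsets of the set [Z] of points that
   fail to extend some clique pair. *)
pose b := 2 ^ (s * (s - 1) * C); pose w := (k - 3)`!.
pose C3 := C0 + w * b + w * (s * k * k).
exists (n1 + C3.+1) => T F le_n F_unif F_free leF maxF.
have [|K1 [K2 [cK1 cK2 dK hL [M [sM tM cM]]]]] := hC T F _ F_unif F_free leF.
  by apply: leq_trans le_n; apply: leq_addr.
exists K1, K2; split=> //.
set L := ksubsets 2 K1 :|: ksubsets 2 K2 in hL sM.
pose V := K1 :|: K2; set F0 := two_clique_family k K1 K2.
have k1 A : A \in F -> #|A :&: K1| != 1.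
  apply: (card_member_clique s1 k5 F_unif F_free cK1) => D hD.
  by apply: (hL D _).1; rewrite inE hD.
have k2 A : A \in F -> #|A :&: K2| != 1.
  apply: (card_member_clique s1 k5 F_unif F_free cK2) => D hD.
  by apply: (hL D _).1; rewrite inE hD orbT.
pose B := [set A in F | [disjoint A & V]].
have FB A : A \in F -> A \notin B -> A \in F0.
  move=> FA; rewrite inE FA /= -setI_eq0 => AV.
  rewrite !inE subsetT F_unif // eqxx k1 // k2 // !andbT /=.
  have : 0 < #|A :&: V| by rewrite card_gt0.
  move: (k1 _ FA) (k2 _ FA).
  rewrite /V setIUr cardsU (_ : (A :&: K1) :&: (A :&: K2) = set0) ?cards0 ?subn0.
    by move: #|_| #|_| => a c; clear; lia.
  by rewrite setIACA setIid (disjoint_setI0 dK) setI0.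
have [B0|[A0]] := set_0Vmem B.
  by apply/subsetP => A FA; apply: FB; rewrite // B0 inE.
rewrite inE => /andP[FA0 dA0]; exfalso.
pose Z := \bigcup_(D in L) ~: extensions s k F D.
have cZ : #|Z| <= s * (s - 1) * C.
  apply: leq_trans (card_bigcup_leq _ _) _.
  rewrite -(clique_pairs_card s_odd cK1 cK2 dK) -sum_nat_const.
  by apply: leq_sum => D /hL[].
have BZ A : A \in F -> [disjoint A & V] -> A \subset Z.
  move=> FA dA; apply/subsetP => x; apply: contraTT => xZ.
  apply: (member_off_cliques s1 k5 F_unif F_free FA dA tM cM).
    by move=> D /(subsetP sM)/clique_pair_sub.
  move=> D /(subsetP sM) LD; apply: contraNT xZ => xN; apply/bigcupP.
  by exists D => //; rewrite inE.
have cB : #|B| <= b.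
  apply: leq_trans (_ : 2 ^ #|Z| <= _); last by rewrite leq_pexp2l.
  rewrite -card_powerset; apply: subset_leq_card; apply/subsetP => A.
  by rewrite !inE => /andP[FA dA]; apply: BZ.
have [x xA0] : exists x, x \in A0.
  by apply/card_gt0P; rewrite F_unif //; apply: leq_trans k5.
have xV : x \notin V by rewrite (disjointFr dA0 xA0).
(* A point [x] of [A0] lies in [Z], so [x |: D] is not a kernel for some clique pair [D], and few
   members of [F] contain it. *)
have /bigcupP[D LD] := subsetP (BZ _ FA0 dA0) _ xA0.
have [sDV cD] := clique_pair_sub LD.
have xD : x \notin D by apply: contra xV; apply: (subsetP sDV).
rewrite !inE xD /= => nker.
have cxD : #|x |: D| = 3 by rewrite cardsU1 xD cD.
have link : #|[set A in F | x |: D \subset A]| <= s * k * k * 'C(#|T|, k - 4).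
  have := card_link_nonkernel F_unif _ _ nker; rewrite cxD; apply.
    by move: k5; clear; lia.
  by rewrite muln_gt0 (ltnW s1); apply: leq_trans k5.
have link0 := two_clique_link_card cK1 cK2 dK (leq_trans _ k5) LD xV.
(* As [F0] is no larger than [F], it has no more sets outside [F] than [F] has outside [F0]. *)
have cF : #|F0 :\: F| <= b.
  have le0 : #|F0| <= #|F| := maxF _ _ cK1 cK2 dK.
  have : #|F| <= #|F0 :&: F| + #|B|.
    apply: leq_trans (leq_card_setU _ _); apply: subset_leq_card.
    apply/subsetP => A FA; rewrite in_setU in_setI FA andbT.
    by have [_|/(FB _ FA)->] := boolP (A \in B); rewrite ?orbT.
  move: le0; rewrite -(cardsID F F0) => h1 h2.
  have := leq_trans h1 h2; rewrite leq_add2l => h3.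
  exact: leq_trans h3 cB.
(* The sets of [F0] containing [x |: D] are either missing from [F] or in its small link; the left
   side is of order [n ^ (k - 3)], the right side only [n ^ (k - 4)]. *)
have le1 : 'C(#|T| - (2 * s).+1, k - 3) <= b + s * k * k * 'C(#|T|, k - 4).
  apply: leq_trans (link0 _) _ => //.
  apply: leq_trans (leq_add cF link).
  apply: leq_trans (leq_card_setU _ _); apply: subset_leq_card.
  apply/subsetP => A /setIdP[F0A sA]; rewrite in_setU in_setD F0A andbT.
  have [FA|//] := boolP (A \in F); apply/setIdP; by split.
have ek : (k - 4).+1 = k - 3 by move: k5; clear; lia.
have T0 : 0 < #|T| by apply: leq_trans le_n; rewrite addnS.
have := hC0 #|T|; rewrite ek -bin_ffact -/w => h.
have : #|T| ^ (k - 3) <= C3 * #|T| ^ (k - 4).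
  apply: leq_trans h _.
  have h2 := leq_mul le1 (leqnn w).
  apply: leq_trans (leq_add h2 (leqnn _)) _.
  have h3 := bin_leq_expn #|T| (k - 4).
  have h4 : 0 < #|T| ^ (k - 4) by rewrite expn_gt0 T0.
  rewrite /C3; move: ('C(_, _)) (_ ^ (k - 4)) (s * k * k) h3 h4.
  by clear; move=> *; nia.
rewrite -ek expnS leq_pmul2r ?expn_gt0 ?T0 // leqNgt => /negP; apply.
by apply: leq_trans le_n; apply: leq_addl.
Qed.

(** The case [s = 1] is excluded because a single k-set is its own core: all k-sets would be
    admissible, while the family in the conclusion would be empty. *)
Theorem theorem1p1 (s k : nat) (s_odd : odd s) (s_gt1 : 1 < s) (k_ge5 : 5 <= k) :
  exists n0 : nat, forall n : nat, n0 <= n ->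
  forall F : {set {set 'I_n}}, extremal s k F ->
  exists G K1 K2 : graph 'I_n,
    [/\ is_clique s K1, is_clique s K2, is_disjoint_union G K1 K2 &
        F = [set A in ksubsets k [set: 'I_n] |
              [&& 2 <= #|A :&: vertices G|,
                  #|A :&: vertices K1| != 1 & #|A :&: vertices K2| != 1]]].
Proof.
have [n0 hn0] := sub_two_clique_family s_odd s_gt1 k_ge5.
(* The summand [2 * s] makes room for two disjoint [s]-sets, whose family gives the lower bound on
   [#|F|]. *)
exists (n0 + 2 * s) => n le_n F [[sF F_free] maxF].
have F_unif : {in F, forall A : {set 'I_n}, #|A| = k}.
  by move=> A /(subsetP sF); rewrite inE => /andP[_ /eqP].
have max2 (K1 K2 : {set 'I_n}) : #|K1| = s -> #|K2| = s -> [disjoint K1 & K2] ->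
    #|two_clique_family k K1 K2| <= #|F|.
  move=> cK1 cK2 dK; apply: maxF; split; last exact: two_clique_free.
  by apply/subsetP => A /setIdP[].
have [|||K1 [K2 [cK1 cK2 dK sF2]]] := hn0 'I_n F _ F_unif F_free.
- by rewrite card_ord; apply: leq_trans le_n; apply: leq_addr.
- have s2n : 2 * s <= n by apply: leq_trans le_n; apply: leq_addl.
  have [|K1 [_ _ cK1]] := @subset_of_card _ s set0 [set: 'I_n] (sub0set _).
    by rewrite cards0 cardsT card_ord; move: s2n; clear; lia.
  have [|K2 [_ sK2 cK2]] := @subset_of_card _ s set0 (~: K1) (sub0set _).
    by rewrite cards0 cardsCs setCK card_ord cK1; move: s2n; clear; lia.
  have dK : [disjoint K1 & K2] by rewrite disjoint_sym disjoints_subset.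
  apply: leq_trans (max2 _ _ cK1 cK2 dK).
  by apply: two_clique_card => //; apply: leq_trans k_ge5.
- exact: max2.
have eF : F = two_clique_family k K1 K2.
  by apply/eqP; rewrite eqEcard sF2 max2.
have sub : ksubsets 2 K1 :|: ksubsets 2 K2 \subset ksubsets 2 (K1 :|: K2).
  by apply/subsetP => D /clique_pair_sub[sD cD]; rewrite inE sD cD.
exists (Graph sub), (Graph (subxx (ksubsets 2 K1))), (Graph (subxx (ksubsets 2 K2))).
by split.
Qed.
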